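(* Let $M$ be a $7$-dimensional Riemannian spin manifold and $(E,g,d)$ as in the context, with $c_3(E,g,d)=0$. Write $\widehat A=\widehat A(TM,\nabla^{TM})$, $T=\widetilde{T_{\mathbf C}M}$, $F=\widetilde{E_{\mathbf C}}$, and $B_1(F)=2\wedge^2F-F\otimes F+F$, $B_2(F)=\wedge^2F\otimes\wedge^2F+2\wedge^4F-2F\otimes\wedge^3F+2F\otimes\wedge^2F-F\otimes F\otimes F+F+\wedge^2F$. Then $$\Big\{\widehat A\big[\mathrm{ch}(\triangle(M)\otimes2T)\,\mathrm{ch}(\triangle(E),g^{\triangle(E)},d)+\mathrm{ch}(\triangle(M))\,\mathrm{ch}(\triangle(E)\otimes B_1(F),g,d)\big]$$ $$+32\widehat A\big[\mathrm{ch}(T+\wedge^2T)\,\mathrm{ch}(\triangle(E),g^{\triangle(E)},d)+\mathrm{ch}(\triangle(E)\otimes B_1(F),g,d)\big]\Big\}^{(7)}$$ $$=240\Big\{\widehat A\,\mathrm{ch}(\triangle(M))\,\mathrm{ch}(\triangle(E),g^{\triangle(E)},d)+32\widehat A\,\mathrm{ch}(\triangle(E),g^{\triangle(E)},d)\Big\}^{(7)},$$ and $$\Big\{\widehat A\big[\mathrm{ch}(\triangle(M)\otimes(2T+\wedge^2T+T\otimes T+S^2T))\,\mathrm{ch}(\triangle(E),g^{\triangle(E)},d)+\mathrm{ch}(\triangle(M)\otimes2T)\,\mathrm{ch}(\triangle(E)\otimes B_1(F),g,d)+\mathrm{ch}(\triangle(M))\,\mathrm{ch}(\triangle(E)\otimes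 B_2(F),g,d)\big]$$ $$+32\widehat A\big[\mathrm{ch}(\wedge^4T+\wedge^2T\otimes T+T\otimes T+S^2T+T)\,\mathrm{ch}(\triangle(E),g^{\triangle(E)},d)+\mathrm{ch}(T+\wedge^2T)\,\mathrm{ch}(\triangle(E)\otimes B_1(F),g,d)+\mathrm{ch}(\triangle(E)\otimes B_2(F),g,d)\big]\Big\}^{(7)}$$ $$=2160\Big\{\widehat A\,\mathrm{ch}(\triangle(M))\,\mathrm{ch}(\triangle(E),g^{\triangle(E)},d)+32\widehat A\,\mathrm{ch}(\triangle(E),g^{\triangle(E)},d)\Big\}^{(7)}.$$
   Context: $\{\omega\}^{(n)}$ is the degree $n$ component of a form $\omega$. $\nabla^{TM}$ is the Levi-Civita connection with curvature $R^{TM}$, $\widehat A(TM,\nabla^{TM})=\det^{1/2}\!\big(\frac{\frac{\sqrt{-1}}{4\pi}R^{TM}}{\sinh(\frac{\sqrt{-1}}{4\pi}R^{TM})}\big)$; $\mathrm{ch}$ of a bundle with connection is $\mathrm{tr}\exp(\frac{\sqrt{-1}}{2\pi}R)$, additive on virtual bundles. $T_{\mathbf C}M=TM\otimes\mathbf C$; $\triangle(M)$ is the spinor bundle of $M$; $\widetilde V=V-\dim V$; exterior and symmetric powers of virtual bundles are defined by $S_t(V)=1/\wedge_{-t}(V)$, $\wedge_t(V-W)=\wedge_t(V)/\wedge_t(W)$, where $\wedge_t(V)=\sum t^i\wedge^iV$, $S_t(V)=\sum t^iS^iV$. Data $(E,g,d)$: $N$ is a sufficiently large even integer, $E=M\times\mathbf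 R^N$ the trivial Euclidean bundle with trivial connection $d$, $E_{\mathbf C}=E\otimes\mathbf C$, $g:M\to SO(N)$ smooth with a lift $g^{\triangle(E)}:M\to\mathrm{Spin}(N)$ acting on the spinor bundle $\triangle(E)$ of $E$ (trivial, rank $2^{N/2}$). A bundle $W$ built from $\triangle(E)$ and $E_{\mathbf C}$ by tensor operations is trivial and carries an induced automorphism $g^W$; its odd Chern character form is $\mathrm{ch}(W,g,d)=\sum_{n\ge1}\frac{n!}{(2n+1)!}\big(\frac1{2\pi\sqrt{-1}}\big)^{n+1}\mathrm{Tr}[((g^W)^{-1}dg^W)^{2n+1}]$, extended additively to virtual bundles (trivial bundles $\mathbf C^m$ carry the identity automorphism). $c_3(E,g,d)=\big(\frac1{2\pi\sqrt{-1}}\big)^2\mathrm{Tr}[(g^{-1}dg)^3]$. *)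

(* Defs.v *)
From HB Require Import structures.
From mathcomp Require Import all_boot all_order all_algebra.
From mathcomp Require Import complex mxtens.

Set Implicit Arguments.
Unset Strict Implicit.
Unset Printing Implicit Defensive.

Import Order.TTheory GRing.Theory Num.Theory.

Local Open Scope ring_scope.

Section ExteriorAlgebra.
Variables (K : comNzRingType) (n : nat).

(* Exterior algebra on the generators dx_0, ..., dx_(n-1): the coefficient of a
   form at A = {a_1 < ... < a_p} is the one of dx_(a_1) /\ ... /\ dx_(a_p). *)
Definition ext_form : Type := {ffun {set 'I_n} -> K^o}.
HB.instance Definition _ := GRing.Lmodule.copy ext_form {ffun {set 'I_n} -> K^o}.

Definition inversions (A B : {set 'I_n}) : nat :=
  (\sum_(i in A) \sum_(j in B) (j < i))%N.

Definition wsign (A B : {set 'I_n}) : K :=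
  if [disjoint A & B] then (-1) ^+ inversions A B else 0.

Definition wedge (a b : ext_form) : ext_form :=
  [ffun D => \sum_A \sum_(B | A :|: B == D) wsign A B * (a A * b B)].

Definition form1 : ext_form := [ffun A => (A == set0)%:R].

Lemma wsign0l A : wsign set0 A = 1.
Proof. by rewrite /wsign disjoints_subset sub0set /inversions big_set0 expr0. Qed.

Lemma wsign0r A : wsign A set0 = 1.
Proof.
rewrite /wsign disjoint_sym disjoints_subset sub0set /inversions big1 ?expr0 //.
by move=> i _; rewrite big_set0.
Qed.

Lemma inversionsUl (A B D : {set 'I_n}) : [disjoint A & B] ->
  inversions (A :|: B) D = (inversions A D + inversions B D)%N.
Proof. by move=> dAB; rewrite /inversions (eq_bigl _ _ (fun x => in_setU x A B)) bigU. Qed.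

Lemma inversionsUr (A B D : {set 'I_n}) : [disjoint B & D] ->
  inversions A (B :|: D) = (inversions A B + inversions A D)%N.
Proof.
move=> dBD; rewrite /inversions -big_split /=; apply: eq_bigr => i _.
by rewrite (eq_bigl _ _ (fun x => in_setU x B D)) bigU.
Qed.

Lemma disjointUr (A B D : {set 'I_n}) :
  [disjoint A & B :|: D] = [disjoint A & B] && [disjoint A & D].
Proof. by rewrite !(disjoint_sym A) -disjointU; apply: eq_disjoint => x; rewrite !inE. Qed.

Lemma wsignA A B D :
  wsign A B * wsign (A :|: B) D = wsign B D * wsign A (B :|: D).
Proof.
rewrite /wsign disjointUr.
have -> : [disjoint A :|: B & D] = [disjoint A & D] && [disjoint B & D].
  by rewrite -disjointU; apply: eq_disjoint => x; rewrite !inE.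
case: (boolP [disjoint A & B]) => dAB; case: (boolP [disjoint B & D]) => dBD;
  rewrite ?andbF ?andFb ?mul0r ?mulr0 //=.
rewrite andbT; case: ifP => _; rewrite ?mulr0 //.
by rewrite -!exprD inversionsUl // inversionsUr // addnA addnC.
Qed.

Lemma sum_wedge (F : {set 'I_n} -> K) (h : {set 'I_n} -> {set 'I_n} -> K) :
  \sum_G F G * (\sum_A \sum_(B | A :|: B == G) h A B) =
  \sum_A \sum_B F (A :|: B) * h A B.
Proof.
transitivity (\sum_G \sum_A \sum_B (if A :|: B == G then F G * h A B else 0)).
  apply: eq_bigr => G _; rewrite mulr_sumr; apply: eq_bigr => A _.
  by rewrite mulr_sumr [LHS]big_mkcond.
rewrite exchange_big; apply: eq_bigr => A _; rewrite exchange_big.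
apply: eq_bigr => B _; rewrite -big_mkcond (big_pred1 (A :|: B)) //.
Qed.

Lemma wedgeA : associative wedge.
Proof.
move=> a b c; apply/ffunP => E; rewrite !ffunE.
pose T (A B D : {set 'I_n}) := if A :|: B :|: D == E then
  wsign A B * wsign (A :|: B) D * (a A * b B * c D) else 0.
transitivity (\sum_A \sum_B \sum_D T A B D).
  apply: eq_bigr => A _.
  transitivity (\sum_G (if A :|: G == E then wsign A G * a A else 0) *
     (\sum_B \sum_(D | B :|: D == G) wsign B D * (b B * c D))).
    rewrite [LHS]big_mkcond; apply: eq_bigr => G _; rewrite ffunE.
    by case: ifP; rewrite ?mul0r // !mulrA.
  rewrite sum_wedge; apply: eq_bigr => B _; apply: eq_bigr => D _.
  rewrite /T setUA; case: ifP; rewrite ?mul0r // => _.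
  by rewrite wsignA mulrACA [wsign A _ * _]mulrC !mulrA.
symmetry; transitivity (\sum_D \sum_A \sum_B T A B D); last first.
  by rewrite exchange_big; apply: eq_bigr => A _; rewrite exchange_big.
transitivity (\sum_D \sum_G (if G :|: D == E then wsign G D * c D else 0) *
     (\sum_A \sum_(B | A :|: B == G) wsign A B * (a A * b B))).
  rewrite exchange_big; apply: eq_bigr => G _.
  rewrite [LHS]big_mkcond; apply: eq_bigr => D _; rewrite ffunE.
  by case: ifP; rewrite ?mul0r // -!mulrA [c D * _]mulrC.
apply: eq_bigr => D _; rewrite sum_wedge; apply: eq_bigr => A _.
apply: eq_bigr => B _; rewrite /T; case: ifP; rewrite ?mul0r // => _.
by rewrite mulrACA [wsign (A :|: B) D * _]mulrC [c D * _]mulrC.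
Qed.

Lemma wedge1l : left_id form1 wedge.
Proof.
move=> a; apply/ffunP => D; rewrite ffunE (bigD1 set0) //= [X in _ + X]big1 ?addr0.
  rewrite (big_pred1 D) => [|B]; last by rewrite set0U.
  by rewrite ffunE eqxx wsign0l !mul1r.
move=> A /negbTE A0; rewrite big1 // => B _; by rewrite ffunE A0 mul0r mulr0.
Qed.

Lemma wedge1r : right_id form1 wedge.
Proof.
move=> a; apply/ffunP => D; rewrite ffunE.
under eq_bigr do rewrite big_mkcond.
rewrite exchange_big (bigD1 set0) //= [X in _ + X]big1 ?addr0.
  rewrite -big_mkcond (big_pred1 D) => [|B]; last by rewrite setU0.
  by rewrite ffunE eqxx wsign0r mul1r mulr1.
move=> A /negbTE A0; rewrite big1 // => B _; by rewrite ffunE A0 !mulr0 if_same.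
Qed.

Lemma wedgeDl : left_distributive wedge +%R.
Proof.
move=> a b c; apply/ffunP => D; rewrite !ffunE -big_split /=.
apply: eq_bigr => A _; rewrite -big_split /=; apply: eq_bigr => B _.
by rewrite !ffunE mulrDl mulrDr.
Qed.

Lemma wedgeDr : right_distributive wedge +%R.
Proof.
move=> a b c; apply/ffunP => D; rewrite !ffunE -big_split /=.
apply: eq_bigr => A _; rewrite -big_split /=; apply: eq_bigr => B _.
by rewrite !ffunE !mulrDr.
Qed.

Lemma form1_neq0 : form1 != 0.
Proof.
apply/eqP => /ffunP /(_ set0); rewrite !ffunE eqxx => /eqP.
by rewrite oner_eq0.
Qed.

HB.instance Definition _ := GRing.Zmodule_isNzRing.Build ext_form
  wedgeA wedge1l wedge1r wedgeDl wedgeDr form1_neq0.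

Lemma form_scaleAl (k : K) (a b : ext_form) : k *: (a * b) = (k *: a) * b.
Proof.
apply/ffunP => D; rewrite !ffunE scaler_sumr; apply: eq_bigr => A _.
rewrite scaler_sumr; apply: eq_bigr => B _; rewrite !ffunE /GRing.scale /=.
by rewrite mulrCA !mulrA.
Qed.

Lemma form_scaleAr (k : K) (a b : ext_form) : k *: (a * b) = a * (k *: b).
Proof.
apply/ffunP => D; rewrite !ffunE scaler_sumr; apply: eq_bigr => A _.
rewrite scaler_sumr; apply: eq_bigr => B _; rewrite !ffunE /GRing.scale /=.
by rewrite mulrCA; congr (_ * _); rewrite mulrCA.
Qed.

HB.instance Definition _ := GRing.Lmodule_isLalgebra.Build K ext_form form_scaleAl.
HB.instance Definition _ := GRing.Lalgebra_isAlgebra.Build K ext_form form_scaleAr.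

Definition form_of (f : {set 'I_n} -> K) : ext_form := [ffun A => f A].

Definition dx (k : 'I_n) : ext_form := form_of (fun A => (A == [set k])%:R).

Definition degree_part (p : nat) (a : ext_form) : ext_form :=
  form_of (fun A => if #|A| == p then a A else 0).

Definition cst_mx r (a : 'M[K]_r) : 'M[ext_form]_r := map_mx (fun c => c%:A) a.

End ExteriorAlgebra.

Section ExteriorPowers.
Variables (r k : nat).

Definition increasing : {set k.-tuple 'I_r} :=
  [set t : k.-tuple 'I_r | sorted ltn [seq val i | i <- t]].

Definition mindex (I : 'I_#|increasing|) (p : 'I_k) : 'I_r := tnth (enum_val I) p.

(* The automorphism v_1 /\ ... /\ v_k |-> a v_1 /\ ... /\ a v_k. *)
Definition ext_mx (K : pzRingType) (a : 'M[K]_r) : 'M[K]_#|increasing| :=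
  \matrix_(I, J) \det (\matrix_(p < k, q < k) a (mindex I p) (mindex J q)).

(* The derivation v_1 /\ ... /\ v_k |-> \sum_p v_1 /\ ... /\ a v_p /\ ... /\ v_k,
   that is, the derivative of [ext_mx] at the identity. *)
Definition ext_deriv (K : pzRingType) (a : 'M[K]_r) : 'M[K]_#|increasing| :=
  \matrix_(I, J) \sum_(p < k) \det (\matrix_(p' < k, q < k)
    if p' == p then a (mindex I p') (mindex J q)
    else (mindex I p' == mindex J q)%:R).

End ExteriorPowers.

Declare Scope virtual_scope.
Delimit Scope virtual_scope with virt.

Record tensor_ops := TensorOps {
  bundle : Type;
  rank : bundle -> nat;
  trivial : nat -> bundle;
  tensor : bundle -> bundle -> bundle;
  ext : nat -> bundle -> bundle }.

Section VirtualBundles.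
Variable T : tensor_ops.

(* A formal difference of bundles: (false, W) stands for W and (true, W) for -W. *)
Definition virtual := seq (bool * bundle T).

Definition vbundle (W : bundle T) : virtual := [:: (false, W)].
Definition vadd (V W : virtual) : virtual := V ++ W.
Definition vopp (V : virtual) : virtual := [seq (~~ v.1, v.2) | v <- V].
Definition vmuln (V : virtual) (n : nat) : virtual := flatten (nseq n V).
Definition vtensor (V W : virtual) : virtual :=
  [seq (v.1 (+) w.1, tensor v.2 w.2) | v <- V, w <- W].

Definition reduced (W : bundle T) : virtual :=
  vadd (vbundle W) (vopp (vbundle (trivial T (rank W)))).

(* Power series in t with virtual coefficients. *)
Definition vseries := nat -> virtual.

Definition vs1 : vseries := fun k => if k is 0 then vbundle (trivial T 1) else [::].

Definition vsmul (a b : vseries) : vseries :=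
  fun k => flatten [seq vtensor (a i) (b (k - i)%N) | i <- iota 0 k.+1].

(* Coefficients 0, ..., k of 1 / a, for a series a with constant term 1. *)
Fixpoint vsinv_seq (a : vseries) (k : nat) : seq virtual :=
  if k is k'.+1 then
    let s := vsinv_seq a k' in
    rcons s (vopp (flatten [seq vtensor (a (k - i)%N) (nth [::] s i) | i <- iota 0 k]))
  else [:: vbundle (trivial T 1)].

Definition vsinv (a : vseries) : vseries := fun k => nth [::] (vsinv_seq a k) k.

Definition wedge_series (V : virtual) : vseries :=
  foldr (fun v a => let w : vseries := fun k => vbundle (ext k v.2) in
                    vsmul (if v.1 then vsinv w else w) a) vs1 V.

Definition vwedge (k : nat) (V : virtual) : virtual := wedge_series V k.

(* S_t(V) = 1 / wedge_(-t)(V) *)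
Definition vsym (k : nat) (V : virtual) : virtual :=
  vsinv (fun i => if odd i then vopp (vwedge i V) else vwedge i V) k.

Definition additive_ext (A : pzRingType) (f : bundle T -> A) (V : virtual) : A :=
  \sum_(v <- V) (-1) ^+ v.1 * f v.2.

End VirtualBundles.

Arguments vbundle {T} W.

Bind Scope virtual_scope with virtual.
Notation "V + W" := (vadd V W) : virtual_scope.
Notation "V - W" := (vadd V (vopp W)) : virtual_scope.
Notation "V * W" := (vtensor V W) : virtual_scope.
Notation "V *+ n" := (vmuln V n) : virtual_scope.
Notation "'\Lambda^' k V" := (vwedge k V)
  (at level 8, k at level 2, V at level 8, format "'\Lambda^' k  V") : virtual_scope.
Notation "'\Sym^' k V" := (vsym k V)
  (at level 8, k at level 2, V at level 8, format "'\Sym^' k  V") : virtual_scope.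

Section CliffordModule.
Variable R : rcfType.
Local Open Scope complex_scope.

(* 2 ^ k, written so that [gamma] needs no cast *)
Definition pow2 (k : nat) : nat := iter k (muln 2) 1%N.

Definition i_sigma1 : 'M[R[i]]_2 := \matrix_(a, b) (if a == b then 0 else 'i).
Definition i_sigma2 : 'M[R[i]]_2 := \matrix_(a, b) (if a == b then 0 else (-1) ^+ a).
Definition sigma3 : 'M[R[i]]_2 := \matrix_(a, b) (if a == b then (-1) ^+ a else 0).

(* For j <= 2k, the matrices gamma k j square to -1 and anticommute. *)
Fixpoint gamma (k j : nat) : 'M[R[i]]_(pow2 k) :=
  match k return 'M[R[i]]_(pow2 k) with
  | 0 => 'i%:M
  | k'.+1 => match j with
             | 0 => i_sigma1 *t 1%:M
             | 1 => i_sigma2 *t 1%:M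
             | j'.+2 => sigma3 *t gamma k' j'
             end
  end.

Definition spin_rank (n : nat) : nat := pow2 n./2.

Definition clifford n (v : 'rV[R]_n) : 'M[R[i]]_(spin_rank n) :=
  \sum_(j < n) (v 0 j)%:C *: gamma n./2 j.

(* Spin(n), embedded in GL of the spinor module of rank 2 ^ floor(n/2), on which
   it acts faithfully: products of an even number of unit vectors. *)
Definition spin n (s : 'M[R[i]]_(spin_rank n)) : Prop :=
  exists us : seq 'rV[R]_n,
    [/\ ~~ odd (size us), all (fun u => u *m u^T == 1%:M) us &
        s = \prod_(u <- us) clifford u].

(* s is an element of Spin(n) whose image in SO(n) is A, i.e. s v s^-1 = A v. *)
Definition spin_over n (s : 'M[R[i]]_(spin_rank n)) (A : 'M[R]_n) : Prop :=
  spin s /\ forall v : 'rV[R]_n, s *m clifford v = clifford (v *m A^T) *m s.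

Definition special_orthogonal n (A : 'M[R]_n) : Prop :=
  A *m A^T = 1%:M /\ \det A = 1.

(* The representation of so(n) on spinors, with form coefficients; its sign is
   the one for which [spin_rep A, clifford v] = clifford (A v). *)
Definition spin_rep n m (A : 'M[ext_form R[i] m]_n) : 'M[ext_form R[i] m]_(spin_rank n) :=
  \sum_(a < n) \sum_(b < n)
    ((4^-1)%:A * A b a) *: cst_mx m (gamma n./2 a *m gamma n./2 b).

End CliffordModule.

From mathcomp Require Import all_classical all_reals all_analysis.
Import numFieldNormedType.Exports.
Local Open Scope classical_set_scope.
Local Open Scope complex_scope.

Section Calculus.
Variables (R : realType) (n : nat).
Implicit Types (U : set 'rV[R]_n) (x : 'rV[R]_n) (k : 'I_n).

Definition partial k (f : 'rV[R]_n -> R) x : R := 'D_(delta_mx 0 k) f x.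

Definition cpartial k (f : 'rV[R]_n -> R[i]) x : R[i] :=
  partial k (fun y => complex.Re (f y)) x +i* partial k (fun y => complex.Im (f y)) x.

Fixpoint Ck (m : nat) U (f : 'rV[R]_n -> R) : Prop :=
  (forall x, U x -> {for x, continuous f}) /\
  if m is m'.+1 then
    forall k, (forall x, U x -> derivable f x (delta_mx 0 k)) /\ Ck m' U (partial k f)
  else True.

Definition smooth_on U (f : 'rV[R]_n -> R) : Prop := forall m, Ck m U f.

Definition csmooth_on U (f : 'rV[R]_n -> R[i]) : Prop :=
  smooth_on U (fun x => complex.Re (f x)) /\ smooth_on U (fun x => complex.Im (f x)).

Definition mx_differential r (a : 'rV[R]_n -> 'M[R[i]]_r) x : 'M[ext_form R[i] n]_r :=
  \matrix_(p, q) \sum_(k < n) cpartial k (fun y => a y p q) x *: dx _ k.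

Definition mx_extd r (w : 'rV[R]_n -> 'M[ext_form R[i] n]_r) x : 'M[ext_form R[i] n]_r :=
  \matrix_(p, q) \sum_(k < n)
    dx _ k * form_of (fun A => cpartial k (fun y => w y p q A) x).

End Calculus.

(* A smooth n-manifold structure on M, given by an atlas that need not be maximal. *)
Record manifold (R : realType) (n : nat) (M : topologicalType) := Manifold {
  ix : Type;
  dom : ix -> set M;
  chart : ix -> M -> 'rV[R]_n;
  param : ix -> 'rV[R]_n -> M;
  manifold_hausdorff : hausdorff_space M;
  manifold_second_countable : @second_countable M;
  dom_open : forall i, open (dom i);
  dom_cover : forall p, exists i, dom i p;
  image_open : forall i, open (chart i @` dom i);
  chartK : forall i p, dom i p -> param i (chart i p) = p;
  chart_continuous : forall i, {within dom i, continuous (chart i)};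
  param_continuous : forall i, {within chart i @` dom i, continuous (param i)};
  change_smooth : forall i j l,
    smooth_on (chart i @` (dom i `&` dom j)) (fun x => chart j (param i x) 0 l) }.

Section Riemannian.
Variables (R : realType) (n : nat) (M : topologicalType) (X : manifold R n M).
Implicit Types (i j : ix X) (x : 'rV[R]_n) (p : M).

Definition chart_image i : set 'rV[R]_n := chart i @` dom i.

(* Row k holds the components of d/dx_k of chart i in the basis d/dy_l of chart j. *)
Definition jac i j x : 'M[R]_n :=
  \matrix_(k, l) partial k (fun y => chart j (param i y) 0 l) x.

Record metric := Metric {
  gram : ix X -> 'rV[R]_n -> 'M[R]_n;
  gram_smooth : forall i a b, smooth_on (chart_image i) (fun x => gram i x a b);
  gram_sym : forall i x, chart_image i x -> (gram i x)^T = gram i x;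
  gram_pos : forall i x, chart_image i x ->
    forall v : 'rV[R]_n, v != 0 -> 0 < (v *m gram i x *m v^T) 0 0;
  gram_change : forall i j p, dom i p -> dom j p ->
    gram i (chart i p) =
    jac i j (chart i p) *m gram j (chart j p) *m (jac i j (chart i p))^T }.

Variable G : metric.

(* christoffel i x k m l is the d/dx_l-component of the Levi-Civita derivative of
   d/dx_m along d/dx_k. *)
Definition christoffel i x (k : 'I_n) : 'M[R]_n :=
  let g a b c := partial c (fun y => gram G i y a b) x in
  \matrix_(m, l) (2^-1 * \sum_(h < n)
    invmx (gram G i x) l h * (g h m k + g h k m - g k m h)).

(* Rows of [frame i x]: coordinates of an orthonormal frame e_i over chart i. The
   matrix [frame_change] h_ij is defined by e_j = e_i h_ij. *)
Definition frame_change (frame : ix X -> 'rV[R]_n -> 'M[R]_n) i j p : 'M[R]_n :=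
  frame i (chart i p) *m gram G i (chart i p) *m
  (frame j (chart j p) *m jac j i (chart j p))^T.

Definition smooth_map r (a : M -> 'M[R]_r) : Prop :=
  forall i b c, smooth_on (chart_image i) (fun x => a (param i x) b c).

Definition csmooth_map r (a : M -> 'M[R[i]]_r) : Prop :=
  forall i b c, csmooth_on (chart_image i) (fun x => a (param i x) b c).

(* A principal Spin(n)-bundle over the frame bundle, given by the transition
   functions of local sections over the charts, which lift those of the frames.
   Every spin structure arises so from the atlas of all charts equipped with such
   a section; the frames are consistently oriented since Spin(n) covers SO(n). *)
Record spin_structure := SpinStructure {
  frame : ix X -> 'rV[R]_n -> 'M[R]_n;
  frame_smooth : forall i a b, smooth_on (chart_image i) (fun x => frame i x a b);
  frame_orthonormal : forall i x, chart_image i x ->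
    frame i x *m gram G i x *m (frame i x)^T = 1%:M;
  spin_change : ix X -> ix X -> M -> 'M[R[i]]_(spin_rank n);
  spin_change_over : forall i j p, dom i p -> dom j p ->
    spin_over (spin_change i j p) (frame_change frame i j p);
  spin_change_smooth : forall i j a b,
    csmooth_on (chart i @` (dom i `&` dom j)) (fun x => spin_change i j (param i x) a b);
  spin_change_cocycle : forall i j k p, dom i p -> dom j p -> dom k p ->
    spin_change i j p *m spin_change j k p = spin_change i k p }.

(* Complex vector bundle with connection: transition functions h_ij, acting on
   columns of components by s_i = h_ij s_j, and connection matrices w_i such that
   (nabla s)_i = d s_i + w_i s_i. *)
Record cbundle := CBundle {
  crank : nat;
  transition : ix X -> ix X -> M -> 'M[R[i]]_crank;
  connection : ix X -> 'rV[R]_n -> 'M[ext_form R[i] n]_crank }.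

Definition ctrivial (m : nat) : cbundle :=
  {| crank := m; transition := fun _ _ _ => 1%:M; connection := fun _ _ => 0 |}.

Definition ctensor (V W : cbundle) : cbundle :=
  {| crank := crank V * crank W;
     transition := fun i j p => transition V i j p *t transition W i j p;
     connection := fun i x => connection V i x *t 1%:M + 1%:M *t connection W i x |}.

Definition cext (k : nat) (V : cbundle) : cbundle :=
  {| crank := #|increasing (crank V) k|;
     transition := fun i j p => ext_mx k (transition V i j p);
     connection := fun i x => ext_deriv k (connection V i x) |}.

Canonical cbundle_ops : tensor_ops := TensorOps crank ctrivial ctensor cext.

Definition curvature (V : cbundle) i x : 'M[ext_form R[i] n]_(crank V) :=
  mx_extd (connection V i) x + connection V i x *m connection V i x.

(* Here and below, sums stop at k = n because forms of degree > n vanish. *)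
Definition ch_bundle i x (V : cbundle) : ext_form R[i] n :=
  \tr (\sum_(k < n.+1)
    (('i / (2 * pi%:C)) ^+ k / (k`!)%:R)%:A *: curvature V i x ^+ k).

Definition ch i x : virtual cbundle_ops -> ext_form R[i] n := additive_ext (ch_bundle i x).

(* Power series of 1/A, of the root of a with constant term 1, and of x/sinh x; each
   terminates, the arguments below being 1 plus a nilpotent, respectively nilpotent. *)
Definition unipotent_inv r (A : 'M[ext_form R[i] n]_r) : 'M[ext_form R[i] n]_r :=
  \sum_(k < n.+1) (1%:M - A) ^+ k.

Definition unipotent_sqrt (a : ext_form R[i] n) : ext_form R[i] n :=
  \sum_(k < n.+1) ((\prod_(j < k) (2^-1 - j%:R)) / (k`!)%:R) *: (a - 1) ^+ k.

Definition x_over_sinh r (A : 'M[ext_form R[i] n]_r) : 'M[ext_form R[i] n]_r :=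
  unipotent_inv (\sum_(k < n.+1) (((k.*2.+1)`!)%:R^-1)%:A *: A ^+ k.*2).

Variable S : spin_structure.

Definition levi_civita i x : 'M[ext_form R[i] n]_n :=
  \matrix_(a, b) \sum_(k < n)
    ((frame S i x *m gram G i x *m
      (\matrix_(c, l) partial k (fun y => frame S i y c l) x +
       frame S i x *m christoffel i x k)^T) a b)%:C *: dx _ k.

Definition complex_tangent : cbundle :=
  {| crank := n;
     transition := fun i j p => map_mx (real_complex R) (frame_change (frame S) i j p);
     connection := levi_civita |}.

Definition spinor_bundle : cbundle :=
  {| crank := spin_rank n;
     transition := spin_change S;
     connection := fun i x => spin_rep (levi_civita i x) |}.

Definition Ahat i x : ext_form R[i] n :=
  unipotent_sqrt (\det (x_over_sinh
    (('i / (4 * pi%:C))%:A *: curvature complex_tangent i x))).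

End Riemannian.

Section OddChern.
Variables (R : realType) (M : topologicalType).

(* Trivial bundle M x C^arank with the trivial connection and an automorphism. *)
Record abundle := ABundle {
  arank : nat;
  automorphism : M -> 'M[R[i]]_arank }.

Definition atrivial (m : nat) : abundle :=
  {| arank := m; automorphism := fun _ => 1%:M |}.

Definition atensor (V W : abundle) : abundle :=
  {| arank := arank V * arank W;
     automorphism := fun p => automorphism V p *t automorphism W p |}.

Definition aext (k : nat) (V : abundle) : abundle :=
  {| arank := #|increasing (arank V) k|;
     automorphism := fun p => ext_mx k (automorphism V p) |}.

Canonical abundle_ops : tensor_ops := TensorOps arank atrivial atensor aext.

Definition complexified N (g : M -> 'M[R]_N) : abundle :=
  {| arank := N; automorphism := fun p => map_mx (real_complex R) (g p) |}.

Variables (n : nat) (X : manifold R n M).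
Implicit Types (i : ix X) (x : 'rV[R]_n).

Definition maurer_cartan i x (W : abundle) : 'M[ext_form R[i] n]_(arank W) :=
  cst_mx n (invmx (automorphism W (param i x))) *m
  mx_differential (fun y => automorphism W (param i y)) x.

Definition ch_odd_bundle i x (W : abundle) : ext_form R[i] n :=
  \sum_(1 <= k < n.+1)
    ((k`!)%:R / ((k.*2.+1)`!)%:R * (2 * pi%:C * 'i) ^- k.+1) *:
      \tr (maurer_cartan i x W ^+ k.*2.+1).

Definition ch_odd i x : virtual abundle_ops -> ext_form R[i] n :=
  additive_ext (ch_odd_bundle i x).

Definition c3 i x (W : abundle) : ext_form R[i] n :=
  (2 * pi%:C * 'i) ^- 2 *: \tr (maurer_cartan i x W ^+ 3).

End OddChern.

Definition B1 (T : tensor_ops) (F : virtual T) : virtual T :=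
  (\Lambda^2 F *+ 2 - F * F + F)%virt.

Definition B2 (T : tensor_ops) (F : virtual T) : virtual T :=
  (\Lambda^2 F * \Lambda^2 F + \Lambda^4 F *+ 2 - (F * \Lambda^3 F) *+ 2
   + (F * \Lambda^2 F) *+ 2 - F * F * F + F + \Lambda^2 F)%virt.

(* Main.v *)
From HB Require Import structures.
Require Import Defs.
From mathcomp Require Import all_boot all_order all_fingroup all_algebra.
From mathcomp Require Import complex mxtens ring zify.
Set Implicit Arguments.
Unset Strict Implicit.
Unset Printing Implicit Defensive.
Import Order.TTheory GRing.Theory Num.Theory.
Local Open Scope ring_scope.

(** Only the component of degree 0 of each even factor matters. Over a chart let
   a_k = g^-1 d_k g and Omega = sum_k a_k dx_k; the odd Chern forms are
   combinations of the traces tr Omega^(2m+1), which vanish for 2m+1 > 7. The form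
   tr Omega^3 is a multiple of c_3, hence zero, and tr Omega^5 = 0 because the a_k
   are antisymmetric. The same vanishing passes to every bundle built from E and
   its spinor bundle DE, so all odd Chern character forms in the statement have
   pure degree 7, the top degree of M. A form acts on forms of top degree through
   its coefficient of degree 0 ([mul_top]). For ch this coefficient is the rank
   ([aug_ch_bundle]), which is 0 for all the virtual bundles built from T that
   occur. The terms containing T drop out, and both sides of either identity apply
   the same operation, once to ch(DE * B_j(F)) and once to ch(DE). It remains to
   show ch(DE * B_1(F)) = 240 ch(DE) and ch(DE * B_2(F)) = 2160 ch(DE).

   The traces of the even powers of Omega vanish ([mxtrace_square_power]), so the
   odd Chern character is a derivation for tensor products ([mxtrace_odd_tens]).
   As products of forms of degree 7 are zero, rank + ch is then multiplicative
   ([total_ch_tensor]). With c = ch(E), D = ch(DE) and d = rank DE, the two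
   remaining inputs are
     ch(Lambda^m F) = (-1)^(m-1) m^3 c for m >= 1  ([total_ch_vwedge]),
     16 D = - d c                                  ([mc_trace_spin3]).
   Since F and the Lambda^m F have rank 0, ch(B_1(F)) = (2 * (-8) + 1) c = -15 c
   and ch(B_2(F)) = (2 * (-64) + 1 - 8) c = -135 c. Therefore
   ch(DE * B_1(F)) = -15 d c = 240 D and ch(DE * B_2(F)) = -135 d c = 2160 D.

   Both inputs come from one recursion ([mxtrace_wick]). The square T = Omega^2 is
   a matrix over the commutative ring of even forms, and
   tr Omega^(2m+1) = sum_k tr(T^m a_k) dx_k. Exterior multiplication
   E * Lambda^k E -> Lambda^(k+1) E and Clifford multiplication E * DE -> DE
   intertwine the automorphisms, and a_k acts on the target as a quadratic
   expression in these multiplications and their adjoints. Moving one factor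
   through T^m and around the trace, the (anti)commutation relations express the
   trace by traces with lower k or lower m. *)

(** * Exterior forms: grading, augmentation, even forms *)

Section Forms.
Variables (F : numFieldType) (n : nat).
Local Notation form := (ext_form F n).
Implicit Types (a b u : form) (A B D : {set 'I_n}) (p q : nat) (k l : 'I_n).

Lemma mul_formE a b D :
  (a * b) D = \sum_A \sum_(B | A :|: B == D) wsign F A B * (a A * b B).
Proof. by rewrite ffunE. Qed.

Lemma scale_formE (c : F) a D : (c *: a) D = c * a D.
Proof. by rewrite ffunE. Qed.

Lemma one_formE D : (1 : form) D = (D == set0)%:R.
Proof. by rewrite ffunE. Qed.

(** The coefficient of degree 0, the ring morphism that kills all the dx_k. *)
Definition aug a : F := a set0.

Lemma aug_is_zmod_morphism : zmod_morphism aug.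
Proof. by move=> a b; rewrite /aug !ffunE. Qed.

Lemma aug_is_monoid_morphism : monoid_morphism aug.
Proof.
split=> [|a b]; rewrite /aug ?one_formE ?eqxx // mul_formE (bigD1 set0) //=.
rewrite [X in _ + X]big1 => [|A /negbTE A0].
  by rewrite (big_pred1 set0) => [|B]; rewrite ?set0U // wsign0l mul1r addr0.
by rewrite big_pred0 // => B; rewrite setU_eq0 A0.
Qed.

HB.instance Definition _ := GRing.isZmodMorphism.Build form F aug aug_is_zmod_morphism.
HB.instance Definition _ := GRing.isMonoidMorphism.Build form F aug aug_is_monoid_morphism.

Lemma augZ c a : aug (c *: a) = c * aug a.
Proof. exact: scale_formE. Qed.

Lemma aug_dx k : aug (dx F k) = 0.
Proof.
rewrite /aug ffunE; case: eqP => // /setP /(_ k).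
by rewrite !inE eqxx.
Qed.

Definition homog p a := forall A, #|A| != p -> a A = 0.

Lemma homog0 p : homog p 0.
Proof. by move=> A _; rewrite ffunE. Qed.

Lemma homogD p a b : homog p a -> homog p b -> homog p (a + b).
Proof. by move=> ha hb A Ap; rewrite ffunE ha ?hb ?addr0. Qed.

Lemma homogZ p c a : homog p a -> homog p (c *: a).
Proof. by move=> ha A Ap; rewrite ffunE ha ?scaler0. Qed.

Lemma homog_sum p (I : Type) (r : seq I) (P : pred I) (f : I -> form) :
  (forall i, P i -> homog p (f i)) -> homog p (\sum_(i <- r | P i) f i).
Proof. by move=> hf; elim/big_ind: _ => //; [exact: homog0 | exact: homogD]. Qed.

Lemma homogM p q a b : homog p a -> homog q b -> homog (p + q) (a * b).
Proof.
move=> ha hb D Dpq; rewrite mul_formE big1 // => A _; rewrite big1 // => B /eqP AB.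
rewrite /wsign; case: ifP => [dAB|]; last by rewrite mul0r.
have [Ap|Ap] := eqVneq #|A| p; last by rewrite ha // mul0r mulr0.
rewrite (hb B) ?mulr0 //; apply: contra Dpq => /eqP Bq.
rewrite -AB cardsU; move: dAB; rewrite -setI_eq0 => /eqP ->.
by rewrite cards0 subn0 Ap Bq.
Qed.

Lemma homog1 : homog 0 1.
Proof. by move=> A; rewrite cards_eq0 one_formE => /negbTE ->. Qed.

Lemma homog_dx k : homog 1 (dx F k).
Proof.
move=> A A1; rewrite ffunE; case: eqP => // Ak.
by rewrite Ak cards1 in A1.
Qed.

Lemma homog_large p a : homog p a -> (n < p)%N -> a = 0.
Proof.
move=> ha np; apply/ffunP => A; rewrite ffunE ha //.
by apply: contraTneq np => <-; rewrite -leqNgt -[X in (_ <= X)%N]card_ord max_card.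
Qed.

Lemma degree_part_homog a : homog n a -> degree_part n a = a.
Proof.
move=> ha; apply/ffunP => A; rewrite ffunE.
by case: eqP => // /eqP /ha ->.
Qed.

(** Only the empty set is disjoint from the support of a form of top degree. *)
Lemma mul_top u a : homog n a -> u * a = aug u *: a.
Proof.
move=> ha; apply/ffunP => D; rewrite mul_formE scale_formE.
have topB B : B != setT -> a B = 0.
  move=> BT; apply: ha; apply: contra BT => /eqP Bn.
  by rewrite eqEcard subsetT /= cardsT card_ord Bn.
rewrite (bigD1 set0) //= [X in _ + X]big1 ?addr0 => [|A A0].
  by rewrite (big_pred1 D) => [|B]; rewrite ?set0U // wsign0l mul1r.
rewrite big1 // => B _; have [->|/topB ->] := eqVneq B setT; last by rewrite !mulr0.
by rewrite /wsign -setI_eq0 setIT (negbTE A0) mul0r.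
Qed.

Lemma inversionsC A B : [disjoint A & B] ->
  (inversions A B + inversions B A = #|A| * #|B|)%N.
Proof.
move=> dAB; rewrite /inversions [X in (_ + X)%N]exchange_big -big_split /=.
rewrite -sum_nat_const; apply: eq_bigr => i iA; rewrite -big_split /= -sum1_card.
apply: eq_bigr => j jB; case: ltngtP => // /val_inj ij.
by move: (disjointFr dAB iA); rewrite -ij jB.
Qed.

(** Every pair (i, j) with i in A and j in B is an inversion in exactly one of the
   two orders. *)
Lemma wsignC A B : wsign F A B = (-1) ^+ (#|A| * #|B|) * wsign F B A.
Proof.
rewrite /wsign disjoint_sym; case: ifP => [dBA|]; last by rewrite mulr0.
rewrite -inversionsC 1?disjoint_sym // exprD -mulrA -exprD addnn -mul2n exprM.
by rewrite sqrrN !expr1n mulr1.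
Qed.

Lemma mul_form_swap (c : F) a b :
  (forall A B, wsign F A B * (a A * b B) = c * (wsign F B A * (b B * a A))) ->
  a * b = c *: (b * a).
Proof.
move=> H; apply/ffunP => D; rewrite scale_formE !mul_formE.
under eq_bigr do rewrite big_mkcond.
rewrite exchange_big mulr_sumr; apply: eq_bigr => A _ /=.
rewrite [in RHS]big_mkcond mulr_sumr; apply: eq_bigr => B _.
by rewrite setUC; case: ifP; rewrite ?mulr0.
Qed.

Lemma homog_comm p q a b : homog p a -> homog q b ->
  a * b = (-1) ^+ (p * q) *: (b * a).
Proof.
move=> ha hb; apply: mul_form_swap => A B.
have [Ap|/ha ->] := eqVneq #|A| p; last by rewrite !(mul0r, mulr0).
have [Bq|/hb ->] := eqVneq #|B| q; last by rewrite !(mul0r, mulr0).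
by rewrite wsignC Ap Bq [b B * _]mulrC !mulrA.
Qed.

Lemma dxC k l : dx F k * dx F l = - (dx F l * dx F k).
Proof. by rewrite (homog_comm (homog_dx k) (homog_dx l)) expr1 scaleN1r. Qed.

Definition is_even : pred form :=
  fun a => [forall A : {set 'I_n}, odd #|A| ==> (a A == 0)].

Lemma is_evenP a : reflect (forall A, odd #|A| -> a A = 0) (is_even a).
Proof.
apply: (iffP forallP) => h A; first by move=> oA; apply/eqP; exact: implyP (h A) oA.
by apply/implyP => /h ->.
Qed.

Lemma is_even_subring : subring_closed is_even.
Proof.
split=> [|a b /is_evenP ha /is_evenP hb|a b /is_evenP ha /is_evenP hb];
  apply/is_evenP => D oD.
- by rewrite one_formE; case: eqP oD => // ->; rewrite cards0.
- by rewrite !ffunE ha ?hb ?subr0.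
rewrite mul_formE big1 // => A _; rewrite big1 // => B /eqP AB.
rewrite /wsign; case: ifP => [dAB|]; last by rewrite mul0r.
move: oD; rewrite -AB cardsU; move: dAB; rewrite -setI_eq0 => /eqP ->.
rewrite cards0 subn0 oddD; case: (boolP (odd #|A|)) => [/ha ->|_ /= /hb ->];
  by rewrite !(mul0r, mulr0).
Qed.

HB.instance Definition _ := GRing.isSubringClosed.Build form is_even is_even_subring.

(** Traces of products are cyclic only over commutative rings, whence this ring: it
   contains the entries of the squares of matrices of 1-forms. *)
Record even_form := EvenForm { ev_val :> form; ev_valP : ev_val \in is_even }.

HB.instance Definition _ := [isSub for ev_val].
HB.instance Definition _ := [Choice of even_form by <:].
HB.instance Definition _ := [SubChoice_isSubNzRing of even_form by <:].

Lemma ev_val_is_zmod_morphism : zmod_morphism ev_val.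
Proof. exact: (rmorphB (val : even_form -> form)). Qed.

Lemma ev_val_is_monoid_morphism : monoid_morphism ev_val.
Proof.
split=> [|x y]; first exact: (rmorph1 (val : even_form -> form)).
exact: (rmorphM (val : even_form -> form)).
Qed.

HB.instance Definition _ :=
  GRing.isZmodMorphism.Build even_form form ev_val ev_val_is_zmod_morphism.
HB.instance Definition _ :=
  GRing.isMonoidMorphism.Build even_form form ev_val ev_val_is_monoid_morphism.

(** wsignC gives the sign (-1)^(|A| |B|), which is 1 as soon as |A| is even. *)
Lemma even_central (e : even_form) a : ev_val e * a = a * ev_val e.
Proof.
rewrite -[RHS]scale1r; apply: mul_form_swap => A B; rewrite mul1r wsignC.
have /is_evenP he := valP e; case: (boolP (odd #|A|)) => [/he ->|eA].
  by rewrite !(mul0r, mulr0).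
by rewrite -signr_odd oddM (negbTE eA) mul1r [a B * _]mulrC.
Qed.

Lemma ev_valM (x y : even_form) : ev_val (x * y) = ev_val x * ev_val y.
Proof. exact: rmorphM. Qed.

Lemma ev_val_inj : injective ev_val.
Proof. exact: val_inj. Qed.

Lemma even_mulC (x y : even_form) : x * y = y * x.
Proof. by apply: ev_val_inj; rewrite !ev_valM even_central. Qed.

HB.instance Definition _ := GRing.PzRing_hasCommutativeMul.Build even_form even_mulC.

End Forms.

Arguments ev_val {F n} e.
Arguments even_form F n : clear implicits.

(** * Matrices of 1-forms and their squares *)

Section OneForms.
Variables (F : numFieldType) (n : nat).
Local Notation form := (ext_form F n).
Local Notation K := (even_form F n).
Implicit Types (k l : 'I_n) (r s : nat).

Lemma even_cst_subproof (c : F) : c%:A \in @is_even F n.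
Proof.
apply/is_evenP => A oA; rewrite scale_formE one_formE.
by case: eqP oA => [->|]; rewrite ?cards0 ?mulr0.
Qed.

Definition even_cst (c : F) : K := EvenForm (even_cst_subproof c).

Lemma even_cst_is_zmod_morphism : zmod_morphism even_cst.
Proof. by move=> a b; apply: ev_val_inj; rewrite rmorphB /= scalerBl. Qed.

Lemma even_cst_is_monoid_morphism : monoid_morphism even_cst.
Proof.
split=> [|a b]; apply: ev_val_inj; rewrite ?rmorph1 ?rmorphM /= ?scale1r //.
by rewrite -scalerAl mul1r scalerA.
Qed.

HB.instance Definition _ :=
  GRing.isZmodMorphism.Build F K even_cst even_cst_is_zmod_morphism.
HB.instance Definition _ :=
  GRing.isMonoidMorphism.Build F K even_cst even_cst_is_monoid_morphism.

Lemma dx2_even_subproof k l : dx F k * dx F l \in @is_even F n.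
Proof.
apply/is_evenP => A oA; apply: (homogM (homog_dx F k) (homog_dx F l)).
by apply: contraTneq oA => ->.
Qed.

Definition dx2 k l : K := EvenForm (dx2_even_subproof k l).

Lemma dx2C k l : dx2 k l = - dx2 l k.
Proof. by apply: ev_val_inj; rewrite rmorphN /= dxC. Qed.

Lemma even_double_eq0 (x : K) : x + x = 0 -> x = 0.
Proof.
move=> x2; apply: ev_val_inj; rewrite rmorph0; apply/ffunP => A.
have := congr1 (fun y : K => ev_val y A) x2; rewrite rmorphD /= !ffunE => /eqP.
by rewrite -mulr2n -mulr_natr mulf_eq0 pnatr_eq0 orbF => /eqP.
Qed.

(** The antisymmetry of dx_k dx_l, in the form in which it cancels cross terms. *)
Lemma dx2_sym_sum r s (f : 'I_n -> 'I_n -> 'M[K]_(r, s)) :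
  (forall k l, f k l = f l k) -> \sum_k \sum_l dx2 k l *: f k l = 0.
Proof.
move=> fC; set S := LHS.
have SN : S = - S.
  rewrite {1}/S exchange_big -sumrN; apply: eq_bigr => k _.
  by rewrite -sumrN; apply: eq_bigr => l _; rewrite dx2C fC scaleNr.
apply/matrixP => p q; rewrite mxE; apply: even_double_eq0.
by rewrite {1}SN mxE addNr.
Qed.

Definition one_form_mx r (a : 'I_n -> 'M[F]_r) : 'M[form]_r :=
  \matrix_(p, q) \sum_k a k p q *: dx F k.

(** The square of [one_form_mx a], as a matrix over the ring of even forms. *)
Definition square_mx r (a : 'I_n -> 'M[F]_r) : 'M[K]_r :=
  \sum_k \sum_l dx2 k l *: map_mx even_cst (a k *m a l).

Lemma eq_one_form_mx r (a b : 'I_n -> 'M[F]_r) :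
  (forall k, a k = b k) -> one_form_mx a = one_form_mx b.
Proof.
by move=> ab; apply/matrixP => p q; rewrite !mxE; apply: eq_bigr => k _; rewrite ab.
Qed.

Lemma one_form_mx_sum r (a : 'I_n -> 'M[F]_r) :
  one_form_mx a = \sum_k dx F k *: cst_mx n (a k).
Proof.
apply/matrixP => p q; rewrite mxE summxE; apply: eq_bigr => k _.
by rewrite !mxE mulr_algr.
Qed.

Lemma cst_mxM r (a b : 'M[F]_r) : cst_mx n (a *m b) = cst_mx n a *m cst_mx n b.
Proof. exact: (map_mxM (in_alg form)). Qed.

Lemma val_even_cst_mx r (a : 'M[F]_r) :
  map_mx ev_val (map_mx even_cst a) = cst_mx n a.
Proof. by apply/matrixP => p q; rewrite !mxE. Qed.

Lemma even_mx_scale r s t (Z : 'M[K]_(r, s)) (x : form) (B : 'M[form]_(s, t)) :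
  map_mx ev_val Z *m (x *: B) = x *: (map_mx ev_val Z *m B).
Proof.
apply/matrixP => p q; rewrite !mxE mulr_sumr; apply: eq_bigr => j _.
by rewrite !mxE !mulrA even_central.
Qed.

Lemma one_form_mx_square r (a : 'I_n -> 'M[F]_r) :
  one_form_mx a *m one_form_mx a = map_mx ev_val (square_mx a).
Proof.
rewrite !one_form_mx_sum mulmx_suml (raddf_sum (map_mx ev_val)); apply: eq_bigr => k _.
rewrite mulmx_sumr (raddf_sum (map_mx ev_val)); apply: eq_bigr => l _ /=.
rewrite -scalemxAl -val_even_cst_mx even_mx_scale scalerA val_even_cst_mx.
rewrite -cst_mxM -val_even_cst_mx.
by apply/matrixP => p q; rewrite !mxE.
Qed.

Lemma square_mx_exp r (a : 'I_n -> 'M[F]_r) m :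
  (one_form_mx a * one_form_mx a) ^+ m = map_mx ev_val (square_mx a ^+ m).
Proof.
rewrite -[_ * _]/(one_form_mx a *m one_form_mx a) one_form_mx_square.
elim: m => [|m IH]; first by rewrite !expr0 map_mx1.
by rewrite !exprS IH [RHS]map_mxM.
Qed.

Lemma mxtrace_even r (Z : 'M[K]_r) : \tr (map_mx ev_val Z) = ev_val (\tr Z).
Proof. by rewrite /mxtrace rmorph_sum /=; apply: eq_bigr => p _; rewrite mxE. Qed.

Lemma mxtrace_even_one_form r (Z : 'M[K]_r) (a : 'I_n -> 'M[F]_r) :
  \tr (map_mx ev_val Z *m one_form_mx a) =
  \sum_k dx F k * ev_val (\tr (Z *m map_mx even_cst (a k))).
Proof.
rewrite one_form_mx_sum mulmx_sumr raddf_sum; apply: eq_bigr => k _ /=.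
rewrite /mxtrace rmorph_sum mulr_sumr; apply: eq_bigr => p _ /=.
rewrite !mxE rmorph_sum mulr_sumr; apply: eq_bigr => q _ /=.
by rewrite !mxE !mulrA even_central.
Qed.

(** Reduces the trace of an odd power of matrices with anticommuting entries to traces
   over a commutative ring, each of them linear in a single a_k. *)
Lemma mxtrace_odd_power r (a : 'I_n -> 'M[F]_r) m :
  \tr (one_form_mx a ^+ m.*2.+1) =
  \sum_k dx F k * ev_val (\tr (square_mx a ^+ m *m map_mx even_cst (a k))).
Proof.
rewrite exprSr -mxtrace_even_one_form -square_mx_exp -mul2n exprM expr2.
by [].
Qed.

Lemma mxtrace_one_form2 r (Z : 'M[K]_r) (a : 'I_n -> 'M[F]_r) :
  \tr (one_form_mx a *m map_mx ev_val Z *m one_form_mx a) =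
  \sum_k \sum_l ev_val (dx2 k l *
    \tr (map_mx even_cst (a k) *m Z *m map_mx even_cst (a l))).
Proof.
rewrite one_form_mx_sum !mulmx_suml raddf_sum; apply: eq_bigr => k _ /=.
rewrite mulmx_sumr raddf_sum; apply: eq_bigr => l _ /=.
rewrite -!val_even_cst_mx -!scalemxAl -map_mxM even_mx_scale scalerA mxtraceZ -map_mxM.
by rewrite mxtrace_even.
Qed.

(** Graded cyclicity: moving one factor Omega around tr Omega^(2m+2) = tr T^(m+1)
   changes its sign. *)
Lemma mxtrace_square_power r (a : 'I_n -> 'M[F]_r) m :
  \tr (square_mx a ^+ m.+1) = 0.
Proof.
set T := square_mx a; pose tw k l := \tr (T ^+ m *m map_mx even_cst (a k *m a l)).
have trT : \tr (T ^+ m.+1) = \sum_k \sum_l dx2 k l * tw k l.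
  rewrite exprSr -[_ * _]/(T ^+ m *m T) mulmx_sumr raddf_sum /=.
  apply: eq_bigr => k _; rewrite mulmx_sumr raddf_sum /=.
  by apply: eq_bigr => l _; rewrite -scalemxAr mxtraceZ.
apply: even_double_eq0; apply/eqP; rewrite addr_eq0; apply/eqP/ev_val_inj.
transitivity (\tr (one_form_mx a *m map_mx ev_val (T ^+ m) *m one_form_mx a)).
  suff -> : one_form_mx a *m map_mx ev_val (T ^+ m) *m one_form_mx a =
    map_mx ev_val (T ^+ m.+1) by rewrite mxtrace_even.
  rewrite -!square_mx_exp -!expr2 -!exprM.
  rewrite -[LHS]/(one_form_mx a * one_form_mx a ^+ (2 * m) * one_form_mx a).
  by rewrite -exprS -exprSr mulnS.
rewrite mxtrace_one_form2 trT exchange_big -sumrN rmorph_sum.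
apply: eq_bigr => k _; rewrite -sumrN rmorph_sum; apply: eq_bigr => l _.
by rewrite dx2C mulNr -mulmxA mxtrace_mulC -mulmxA -map_mxM.
Qed.

End OneForms.

(** * Kronecker products and the Wick recursion *)

Section TensorProducts.
Variable K : comNzRingType.

Lemma tensmxDl m n p q (A B : 'M[K]_(m, n)) (C : 'M[K]_(p, q)) :
  (A + B) *t C = A *t C + B *t C.
Proof. by apply/matrixP => i j; rewrite !mxE mulrDl. Qed.

Lemma tensmxDr m n p q (A : 'M[K]_(m, n)) (B C : 'M[K]_(p, q)) :
  A *t (B + C) = A *t B + A *t C.
Proof. by apply/matrixP => i j; rewrite !mxE mulrDr. Qed.

Lemma tensmxZl m n p q (c : K) (A : 'M[K]_(m, n)) (B : 'M[K]_(p, q)) :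
  (c *: A) *t B = c *: (A *t B).
Proof. by apply/matrixP => i j; rewrite !mxE mulrA. Qed.

Lemma tensmxZr m n p q (c : K) (A : 'M[K]_(m, n)) (B : 'M[K]_(p, q)) :
  A *t (c *: B) = c *: (A *t B).
Proof. by apply/matrixP => i j; rewrite !mxE mulrCA. Qed.

Lemma tensmx_suml m n p q (I : finType) (A : I -> 'M[K]_(m, n)) (B : 'M[K]_(p, q)) :
  (\sum_i A i) *t B = \sum_i A i *t B.
Proof.
by apply: (big_morph (fun A => A *t B)) => [x y|]; [exact: tensmxDl | exact: tens0mx].
Qed.

Lemma tensmx_sumr m n p q (I : finType) (A : 'M[K]_(m, n)) (B : I -> 'M[K]_(p, q)) :
  A *t (\sum_i B i) = \sum_i A *t B i.
Proof.
by apply: (big_morph (fun B => A *t B)) => [x y|]; [exact: tensmxDr | exact: tensmx0].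
Qed.

Lemma tensmx11 m n : (1%:M : 'M[K]_m) *t (1%:M : 'M[K]_n) = 1%:M.
Proof.
apply/matrixP => i j; case: (mxtens_indexP i) => i0 i1; case: (mxtens_indexP j) => j0 j1.
rewrite tensmxE !mxE (can_eq (@mxtens_indexK m n)) xpair_eqE.
by case: (i0 == j0); rewrite ?mul0r ?mul1r.
Qed.

Lemma big_mxtens_index (V : nmodType) m n (f : 'I_(m * n) -> V) :
  \sum_i f i = \sum_(i < m) \sum_(j < n) f (mxtens_index (i, j)).
Proof.
rewrite pair_bigA (reindex (@mxtens_index m n)) /=; first by apply: eq_bigr => -[].
by exists (@mxtens_unindex m n) => x _; rewrite (mxtens_indexK, mxtens_unindexK).
Qed.

Lemma mxtrace_tens m n (A : 'M[K]_m) (B : 'M[K]_n) : \tr (A *t B) = \tr A * \tr B.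
Proof.
rewrite /mxtrace big_mxtens_index mulr_suml; apply: eq_bigr => i _.
by rewrite mulr_sumr; apply: eq_bigr => j _; rewrite tensmxE.
Qed.

Lemma tens_exp m n (A : 'M[K]_m) (B : 'M[K]_n) p q :
  ((A *t 1%:M) ^+ p * (1%:M *t B) ^+ q) = (A ^+ p) *t (B ^+ q).
Proof.
have -> : (A *t (1%:M : 'M_n)) ^+ p = (A ^+ p) *t 1%:M.
  by elim: p => [|p IH]; rewrite ?expr0 ?tensmx11 // !exprS IH [LHS]tensmx_mul mulmx1.
have -> : ((1%:M : 'M_m) *t B) ^+ q = 1%:M *t (B ^+ q).
  by elim: q => [|q IH]; rewrite ?expr0 ?tensmx11 // !exprS IH [LHS]tensmx_mul mulmx1.
by rewrite [LHS]tensmx_mul mulmx1 mul1mx.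
Qed.

Lemma tens_sum_exp m n (A : 'M[K]_m) (B : 'M[K]_n) p :
  (A *t 1%:M + 1%:M *t B) ^+ p =
  \sum_(j < p.+1) (A ^+ (p - j) *t B ^+ j) *+ 'C(p, j).
Proof.
rewrite exprDn_comm; last by rewrite /GRing.comm ![_ * _]tensmx_mul !mulmx1 !mul1mx.
by apply: eq_bigr => j _; rewrite tens_exp.
Qed.

End TensorProducts.

Lemma mulmxMnl (K : pzRingType) m n p (A : 'M[K]_(m, n)) (B : 'M[K]_(n, p)) k :
  (A *+ k) *m B = (A *m B) *+ k.
Proof. by rewrite -!scaler_nat scalemxAl. Qed.

Section Wick.
Variables (K : comNzRingType) (N r r' : nat).
Implicit Types (C : 'I_N -> 'M[K]_(r, r')) (D : 'I_N -> 'M[K]_(r', r)).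

(** The blocks C_1, ..., C_N side by side: the map sending e_i tensor w to C_i w. *)
Definition row_blocks C : 'M[K]_(r, N * r') :=
  \matrix_(x, y) C (mxtens_unindex y).1 x (mxtens_unindex y).2.

Lemma row_blocksE C x i y : row_blocks C x (mxtens_index (i, y)) = C i x y.
Proof. by rewrite mxE mxtens_indexK. Qed.

Lemma row_blocks_tens C (A : 'M[K]_N) (B : 'M[K]_r') :
  row_blocks C *m (A *t B) = row_blocks (fun i => \sum_c A c i *: (C c *m B)).
Proof.
apply/matrixP => x z; case: (mxtens_indexP z) => i y.
rewrite row_blocksE mxE big_mxtens_index summxE; apply: eq_bigr => c _.
rewrite !mxE mulr_sumr; apply: eq_bigr => w _.
by rewrite row_blocksE tensmxE mulrCA.
Qed.

Lemma mul_row_blocks C (T : 'M[K]_r) :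
  T *m row_blocks C = row_blocks (fun i => T *m C i).
Proof.
apply/matrixP => x z; case: (mxtens_indexP z) => i y.
by rewrite row_blocksE !mxE; apply: eq_bigr => w _; rewrite row_blocksE.
Qed.

Lemma row_blocksD C C' : row_blocks C + row_blocks C' = row_blocks (fun i => C i + C' i).
Proof. by apply/matrixP => x z; rewrite !mxE. Qed.

Lemma row_blocks_inj C C' : row_blocks C = row_blocks C' -> forall i, C i = C' i.
Proof.
move=> CC' i; apply/matrixP => x y.
by rewrite -row_blocksE CC' row_blocksE.
Qed.

Lemma eq_row_blocks C C' : (forall i, C i = C' i) -> row_blocks C = row_blocks C'.
Proof. by move=> e; apply/matrixP => x y; rewrite !mxE e. Qed.

(** For C seen as a map from the tensor product of the N-dimensional and the
   r'-dimensional module, equivariance can be checked on one block at a time. *)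
Lemma row_blocks_intertwine C (T : 'M[K]_r) (A : 'M[K]_N) (B : 'M[K]_r') :
  (forall i, T *m C i = \sum_c A c i *: C c + C i *m B) <->
  T *m row_blocks C = row_blocks C *m (A *t 1%:M + 1%:M *t B).
Proof.
rewrite mul_row_blocks mulmxDr !row_blocks_tens row_blocksD.
have E i : \sum_c A c i *: (C c *m 1%:M) + \sum_c 1%:M c i *: (C c *m B) =
    \sum_c A c i *: C c + C i *m B.
  congr (_ + _); first by apply: eq_bigr => c _; rewrite mulmx1.
  rewrite (bigD1 i) //= [X in _ + X]big1 ?addr0 => [|c /negbTE ci].
    by rewrite mxE eqxx scale1r.
  by rewrite mxE ci scale0r.
split=> [TC|/row_blocks_inj TC i]; last by rewrite TC E.
by apply: eq_row_blocks => i; rewrite E TC.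
Qed.

Lemma sum_mulmx (A X : 'M[K]_N) (h : 'I_N -> 'I_N -> K) :
  \sum_c \sum_l X c l * (\sum_e A e c * h e l) = \sum_e \sum_l (A *m X) e l * h e l.
Proof.
under [RHS]eq_bigr => e _ do under eq_bigr => l _ do rewrite mxE mulr_suml.
under [RHS]eq_bigr => e _ do rewrite exchange_big.
rewrite [RHS]exchange_big; apply: eq_bigr => c _ /=.
rewrite [RHS]exchange_big; apply: eq_bigr => l _ /=.
by rewrite mulr_sumr; apply: eq_bigr => e _; rewrite mulrA [X c l * _]mulrC.
Qed.

Definition wick_pairing (G : 'I_N -> 'I_N -> 'M[K]_r') (X : 'M[K]_N) : 'M[K]_r' :=
  \sum_c \sum_l X c l *: G c l.

(** The recursion behind all trace computations. By equivariance T^m C_i is a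
   combination of the C_c T'^j; cyclicity of the trace then brings D_l next to C_c,
   where the relation between D_l C_c and G_cl applies. For fermionic operators
   G_cl is again a product of a creation and an annihilation operator, one degree
   lower or on the same space, so the last term is a trace of the same kind. *)
Lemma mxtrace_wick C D (G : 'I_N -> 'I_N -> 'M[K]_r') (kappa : K)
    (T : 'M[K]_r) (T' : 'M[K]_r') (Y X : 'M[K]_N) m :
  T *m row_blocks C = row_blocks C *m (Y *t 1%:M + 1%:M *t T') ->
  (forall c l, D l *m C c = (kappa *+ (c == l))%:M - G c l) ->
  \tr (T ^+ m *m \sum_c \sum_l X c l *: (C c *m D l)) =
  \sum_(j < m.+1) (kappa * \tr (Y ^+ (m - j) *m X) * \tr (T' ^+ j)
     - \tr (T' ^+ j *m wick_pairing G (Y ^+ (m - j) *m X))) *+ 'C(m, j).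
Proof.
move=> TC DC.
have TmC : T ^+ m *m row_blocks C =
    row_blocks C *m (Y *t 1%:M + 1%:M *t T') ^+ m.
  elim: m => [|m IH]; first by rewrite !expr0 mul1mx mulmx1.
  rewrite exprSr -[_ * T]/(T ^+ m *m T) -mulmxA TC mulmxA IH -mulmxA.
  by rewrite exprSr.
have {}TmC i : T ^+ m *m C i =
    \sum_(j < m.+1) (\sum_c (Y ^+ (m - j)) c i *: (C c *m T' ^+ j)) *+ 'C(m, j).
  move: TmC; rewrite mul_row_blocks tens_sum_exp mulmx_sumr.
  have -> : \sum_(j < m.+1) row_blocks C *m (Y ^+ (m - j) *t T' ^+ j *+ 'C(m, j)) =
     row_blocks (fun i => \sum_(j < m.+1)
       (\sum_c (Y ^+ (m - j)) c i *: (C c *m T' ^+ j)) *+ 'C(m, j)).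
    apply/matrixP => x z; case: (mxtens_indexP z) => {}i y.
    rewrite row_blocksE !summxE; apply: eq_bigr => j _.
    by rewrite raddfMn /= row_blocks_tens !mulmxnE row_blocksE.
  by move/row_blocks_inj.
pose E j e l := \tr (T' ^+ j *m (D l *m C e)).
transitivity (\sum_c \sum_l X c l *
    \sum_(j < m.+1) (\sum_e (Y ^+ (m - j)) e c * E j e l) *+ 'C(m, j)).
  rewrite mulmx_sumr raddf_sum; apply: eq_bigr => c _ /=.
  rewrite mulmx_sumr raddf_sum; apply: eq_bigr => l _ /=.
  rewrite -scalemxAr mxtraceZ mulmxA TmC mulmx_suml raddf_sum; congr (_ * _).
  apply: eq_bigr => j _ /=; rewrite mulmxMnl raddfMn /=.
  congr (_ *+ _); rewrite mulmx_suml raddf_sum; apply: eq_bigr => e _ /=.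
  by rewrite -scalemxAl mxtraceZ -mulmxA mxtrace_mulC -mulmxA.
transitivity (\sum_(j < m.+1) (\sum_e \sum_l (Y ^+ (m - j) *m X) e l * E j e l) *+ 'C(m, j)).
  under eq_bigr => c _ do under eq_bigr => l _ do rewrite mulr_sumr.
  under eq_bigr => c _ do rewrite exchange_big.
  rewrite exchange_big; apply: eq_bigr => j _ /=.
  rewrite -sum_mulmx -sumrMnl; apply: eq_bigr => c _; rewrite -sumrMnl.
  by apply: eq_bigr => l _; rewrite mulrnAr.
apply: eq_bigr => j _; congr (_ *+ _).
set Z := Y ^+ _ *m X; rewrite /wick_pairing mulmx_sumr (raddf_sum (@mxtrace _ _)).
have -> : kappa * \tr Z * \tr (T' ^+ j) =
    \sum_e \sum_l Z e l * (kappa *+ (e == l) * \tr (T' ^+ j)).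
  rewrite [kappa * _]mulr_sumr mulr_suml; apply: eq_bigr => e _.
  rewrite (bigD1 e) //= [X in _ + X]big1 ?addr0 => [|l /negbTE le].
    by rewrite eqxx mulr1n mulrA [Z e e * _]mulrC.
  by rewrite eq_sym le mul0r mulr0.
rewrite -sumrB; apply: eq_bigr => e _ /=.
rewrite mulmx_sumr (raddf_sum (@mxtrace _ _)) -sumrB; apply: eq_bigr => l _ /=.
rewrite -scalemxAr mxtraceZ -mulrBr /E DC mulmxBr raddfB /=.
by rewrite mul_mx_scalar mxtraceZ.
Qed.

End Wick.

Section Families.
Variables (F : numFieldType) (n : nat).
Local Notation K := (even_form F n).
Implicit Types (k l : 'I_n) (r s m : nat).

(** A constant intertwiner for the matrices of 1-forms also intertwines their squares. *)
Lemma square_mx_intertwine r s (a : 'I_n -> 'M[F]_r) (b : 'I_n -> 'M[F]_s)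
    (C : 'M[F]_(r, s)) :
  (forall k, a k *m C = C *m b k) ->
  square_mx a *m map_mx (@even_cst F n) C = map_mx (@even_cst F n) C *m square_mx b.
Proof.
move=> aC; rewrite mulmx_suml mulmx_sumr; apply: eq_bigr => k _.
rewrite mulmx_suml mulmx_sumr; apply: eq_bigr => l _.
by rewrite -scalemxAl -scalemxAr -!map_mxM -mulmxA aC mulmxA aC mulmxA.
Qed.

(** The cross terms a_k tensor b_l + a_l tensor b_k are symmetric in k and l. *)
Lemma square_mx_tens r s (a : 'I_n -> 'M[F]_r) (b : 'I_n -> 'M[F]_s) :
  square_mx (fun k => a k *t 1%:M + 1%:M *t b k) =
  square_mx a *t 1%:M + 1%:M *t square_mx b.
Proof.
transitivity (\sum_k \sum_l dx2 F k l *: map_mx (@even_cst F n)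
   ((a k *m a l) *t 1%:M + 1%:M *t (b k *m b l))
   + \sum_k \sum_l dx2 F k l *: map_mx (@even_cst F n) (a k *t b l + a l *t b k)).
  rewrite -big_split; apply: eq_bigr => k _; rewrite -big_split; apply: eq_bigr => l _.
  rewrite /= -scalerDr -map_mxD mulmxDl !mulmxDr !tensmx_mul !mulmx1 !mul1mx.
  by congr (_ *: map_mx _ _); rewrite [X in _ + X = _]addrC addrACA.
rewrite [X in _ + X]dx2_sym_sum ?addr0 => [|k l]; last by rewrite addrC.
rewrite tensmx_suml tensmx_sumr -big_split; apply: eq_bigr => k _.
rewrite tensmx_suml tensmx_sumr -big_split; apply: eq_bigr => l _ /=.
by rewrite tensmxZl tensmxZr -scalerDr map_mxD !map_mxT !map_mx1.
Qed.

(** In the binomial expansion of T^m every mixed term contains the trace of a positive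
   power of the square of one of the two factors, hence vanishes. *)
Lemma mxtrace_odd_tens r s (a : 'I_n -> 'M[F]_r) (b : 'I_n -> 'M[F]_s) m :
  \tr (one_form_mx (fun k => a k *t 1%:M + 1%:M *t b k) ^+ m.*2.+1) =
  \tr (one_form_mx a ^+ m.*2.+1) *+ s + \tr (one_form_mx b ^+ m.*2.+1) *+ r.
Proof.
rewrite !mxtrace_odd_power -!sumrMnl -big_split; apply: eq_bigr => k _ /=.
rewrite -!mulrnAr -!rmorphMn -mulrDr -rmorphD; congr (_ * ev_val _).
rewrite square_mx_tens tens_sum_exp mulmx_suml raddf_sum /=.
rewrite map_mxD !map_mxT !map_mx1.
under eq_bigr => j _.
  rewrite -scaler_nat -scalemxAl mxtraceZ mulmxDr !tensmx_mul !mulmx1 mxtraceD.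
  rewrite !mxtrace_tens; over.
under eq_bigr do rewrite mulrDr; rewrite big_split /=; congr (_ + _).
  rewrite big_ord_recl big1 => [|j _]; last by rewrite mxtrace_square_power !mulr0.
  by rewrite bin0 mul1r subn0 expr0 mxtrace1 addr0 mulr_natr.
rewrite big_ord_recr big1 /= => [|j _].
  by rewrite binn mul1r subnn expr0 mxtrace1 add0r mulr_natl.
by rewrite -subnSK // mxtrace_square_power mul0r mulr0.
Qed.

End Families.

(** * Minors and exterior multiplication *)

Section IncreasingTuples.
Variable N : nat.

Lemma mindex_lt k (I : 'I_#|increasing N k|) (p q : 'I_k) :
  (p < q)%N -> (mindex I p < mindex I q)%N.
Proof.
have := enum_valP I; rewrite inE /mindex => sI pq.
have := sorted_ltn_nth ltn_trans 0 sI.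
move=> /(_ p q); rewrite !inE size_map size_tuple !ltn_ord => /(_ isT isT pq).
by rewrite !(nth_map (tnth (enum_val I) p)) ?size_tuple // -!tnth_nth.
Qed.

Lemma mindex_inj k (I : 'I_#|increasing N k|) : injective (mindex I).
Proof.
move=> p q e; apply: val_inj => /=; case: (ltngtP p q) => // /(mindex_lt I);
  by rewrite e ltnn.
Qed.

Lemma mindexP k (w : 'I_k -> 'I_N) :
  (forall p q : 'I_k, (p < q)%N -> (w p < w q)%N) -> exists I, mindex I =1 w.
Proof.
move=> wlt; pose t := [tuple w p | p < k].
have tI : t \in increasing N k.
  rewrite inE; apply/(sortedP 0) => i; rewrite size_map size_tuple => ik.
  have ik' : (i < k)%N by apply: ltnW.
  rewrite !(nth_map (w (Ordinal ik'))) ?size_tuple //.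
  rewrite -(tnth_nth _ t (Ordinal ik')) -(tnth_nth _ t (Ordinal ik)) !tnth_mktuple.
  exact: wlt.
exists (enum_rank_in tI t) => p.
by rewrite /mindex enum_rankK_in // tnth_mktuple.
Qed.

Lemma mindex_eq k (I J : 'I_#|increasing N k|) :
  (forall p, exists q, mindex I p = mindex J q) -> I = J.
Proof.
move=> IJ; apply: enum_val_inj; apply/val_inj/(inj_map val_inj).
have := enum_valP I; rewrite inE => sI; have := enum_valP J; rewrite inE => sJ.
apply: (irr_sorted_eq ltn_trans ltnn sI sJ).
have uI : uniq (map val (enum_val I)) := sorted_uniq ltn_trans ltnn sI.
have sub : {subset map val (enum_val I) <= map val (enum_val J)}.
  move=> _ /mapP[i iI ->]; rewrite mem_map; last exact: val_inj.
  by have /tnthP[p ->] := iI; have [q] := IJ p; rewrite /mindex => ->; exact: mem_tnth.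
by have [] := uniq_min_size uI sub; rewrite ?size_map ?size_tuple.
Qed.

Lemma mindex_perm k (v : 'I_k -> 'I_N) : injective v ->
  exists I : 'I_#|increasing N k|, exists s : 'S_k, forall q, v q = mindex I (s q).
Proof.
move=> v_inj; pose l := [tuple v p | p < k].
pose leo := fun i j : 'I_N => (i <= j)%N.
have tot : total leo by move=> i j; exact: leq_total.
have /tuple_permP[s sl] : perm_eq (sort leo l) l by rewrite perm_sort.
have lI : [tuple tnth l (s i) | i < k] \in increasing N k.
  rewrite inE -sl ltn_sorted_uniq_leq (map_inj_uniq val_inj) sort_uniq.
  rewrite map_inj_uniq ?enum_uniq //=.
  by rewrite sorted_map; apply: sort_sorted.
exists (enum_rank_in lI [tuple tnth l (s i) | i < k]), s^-1%g => q.
by rewrite /mindex enum_rankK_in // !tnth_mktuple permKV.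
Qed.

End IncreasingTuples.

Section Minors.
Variables (K : comNzRingType) (N : nat).
Local Notation inc k := 'I_#|increasing N k|.
Implicit Types (h g : 'M[K]_N) (k : nat).

Definition minor k h (u v : 'I_k -> 'I_N) : K :=
  \det (\matrix_(p, q) h (u p) (v q)).

Lemma eq_minor k h (u u' v v' : 'I_k -> 'I_N) :
  u =1 u' -> v =1 v' -> minor h u v = minor h u' v'.
Proof. by move=> eu ev; congr (\det _); apply/matrixP => p q; rewrite !mxE eu ev. Qed.

Lemma ext_mxE k h (I J : inc k) : ext_mx k h I J = minor h (mindex I) (mindex J).
Proof. by rewrite mxE. Qed.

Lemma minor_tr k h (u v : 'I_k -> 'I_N) : minor h^T u v = minor h v u.
Proof. by rewrite /minor -det_tr; congr (\det _); apply/matrixP => p q; rewrite !mxE. Qed.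

Lemma minor1C k (u v : 'I_k -> 'I_N) : minor 1%:M u v = minor 1%:M v u.
Proof. by rewrite -minor_tr trmx1. Qed.

Lemma minor_perm k h (u v : 'I_k -> 'I_N) (s : 'S_k) :
  minor h u (v \o s) = (-1) ^+ s * minor h u v.
Proof.
have -> : minor h u (v \o s) = \det (col_perm s (\matrix_(p, q) h (u p) (v q))).
  by congr (\det _); apply/matrixP => p q; rewrite !mxE.
by rewrite col_permE det_mulmx det_perm odd_permV mulrC.
Qed.

Lemma minor_noninj k h (u v : 'I_k -> 'I_N) (p q : 'I_k) :
  p != q -> v p = v q -> minor h u v = 0.
Proof.
move=> pq vpq; rewrite -minor_tr; apply: (determinant_alternate pq) => j.
by rewrite !mxE vpq.
Qed.

Lemma minor1_mindex k (I J : inc k) : minor 1%:M (mindex I) (mindex J) = (I == J)%:R.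
Proof.
have [->|IJ] := eqVneq I J.
  rewrite -[RHS](det1 _ k); congr (\det _); apply/matrixP => p q.
  by rewrite !mxE (inj_eq (@mindex_inj _ _ J)).
have /existsP[p /forallP pJ] : [exists p, forall q, mindex I p != mindex J q].
  apply: contraR IJ => /existsPn IJ.
  apply/eqP/mindex_eq => p; have := IJ p; rewrite negb_forall => /existsP[q].
  by rewrite negbK => /eqP; exists q.
rewrite /minor (expand_det_row _ p) big1 // => q _.
by rewrite !mxE (negbTE (pJ q)) mul0r.
Qed.

(** The basis e_K of the exterior power, with K increasing, resolves the identity:
   v is injective and sorts to a single K up to a permutation, or both sides vanish. *)
Lemma minor_complete k h (u v : 'I_k -> 'I_N) :
  \sum_L minor h u (mindex L) * minor 1%:M (mindex L) v = minor h u v.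
Proof.
case: (boolP (injectiveb v)) => [/injectiveP|/injectivePn[p [q pq vpq]]].
  move=> /mindex_perm[I [s vI]].
  have ev h' u' : minor h' u' v = (-1) ^+ s * minor h' u' (mindex I).
    by rewrite -minor_perm; apply: eq_minor => // q; rewrite vI.
  rewrite (bigD1 I) //= [X in _ + X]big1 ?addr0 => [|L LI].
    by rewrite !ev minor1_mindex eqxx mulr1 mulrC.
  by rewrite ev minor1_mindex (negbTE LI) !mulr0.
by rewrite (minor_noninj h u pq vpq) big1 // => L _; rewrite (minor_noninj _ _ pq vpq) mulr0.
Qed.

Lemma minor_completel k h (u v : 'I_k -> 'I_N) :
  \sum_L minor 1%:M u (mindex L) * minor h (mindex L) v = minor h u v.
Proof.
rewrite -minor_tr -minor_complete; apply: eq_bigr => L _.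
by rewrite minor_tr mulrC minor1C.
Qed.

Definition fcons k (i : 'I_N) (u : 'I_k -> 'I_N) : 'I_k.+1 -> 'I_N :=
  fun p => if unlift ord0 p is Some p' then u p' else i.

Lemma fcons0 k i (u : 'I_k -> 'I_N) : fcons i u ord0 = i.
Proof. by rewrite /fcons unlift_none. Qed.

Lemma fconsS k i (u : 'I_k -> 'I_N) (p : 'I_k) : fcons i u (lift ord0 p) = u p.
Proof. by rewrite /fcons liftK. Qed.

Lemma minor_laplace k h (u : 'I_k.+1 -> 'I_N) i (v : 'I_k -> 'I_N) :
  minor h u (fcons i v) =
  \sum_(p < k.+1) (-1) ^+ p * h (u p) i * minor h (u \o lift p) v.
Proof.
rewrite /minor (expand_det_col _ ord0); apply: eq_bigr => p _.
rewrite !mxE fcons0 /cofactor addn0 mulrCA mulrA; congr (_ * \det _).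
by apply/matrixP => p' q'; rewrite !mxE fconsS.
Qed.

Lemma minor_fconsC k h (u : 'I_k.+2 -> 'I_N) i j (v : 'I_k -> 'I_N) :
  minor h u (fcons i (fcons j v)) = - minor h u (fcons j (fcons i v)).
Proof.
pose s : 'S_k.+2 := tperm ord0 (lift ord0 ord0).
transitivity (minor h u (fcons j (fcons i v) \o s)); last first.
  by rewrite minor_perm odd_tperm /= expr1 mulN1r.
apply: eq_minor => // p; rewrite /= /s.
case: (unliftP ord0 p) => [p' ->|->]; last by rewrite tpermL fcons0 fconsS fcons0.
rewrite fconsS; case: (unliftP ord0 p') => [q ->|->].
  by rewrite tpermD ?fconsS // -?val_eqE.
by rewrite tpermR !fcons0.
Qed.

(** Exterior multiplication by e_i in the bases of increasing tuples. Writing its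
   entries as minors of the identity matrix leaves all signs to the determinant. *)
Definition creation k (i : 'I_N) : 'M[K]_(#|increasing N k.+1|, #|increasing N k|) :=
  \matrix_(I, J) minor 1%:M (mindex I) (fcons i (mindex J)).

Lemma ext_creation k h i I J :
  (ext_mx k.+1 h *m creation k i) I J = minor h (mindex I) (fcons i (mindex J)).
Proof.
by rewrite mxE -minor_complete; apply: eq_bigr => L _; rewrite !mxE.
Qed.

Lemma creation_mul k s (H : 'M[K]_(#|increasing N k|, s)) h c I J (w : 'I_k -> 'I_N) :
  (forall L, H L J = minor h (mindex L) w) ->
  (creation k c *m H) I J =
  \sum_(p < k.+1) (-1) ^+ p * (mindex I p == c)%:R * minor h (mindex I \o lift p) w.
Proof.
move=> HE; rewrite mxE; under eq_bigr => L _ do rewrite mxE HE minor_laplace mulr_suml.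
rewrite exchange_big; apply: eq_bigr => p _ /=.
rewrite -minor_completel mulr_sumr; apply: eq_bigr => L _.
by rewrite mxE mulrA.
Qed.

(** Both sides compute minors: one by completeness, the other by Laplace expansion. *)
Lemma ext_mx_intertwine k h i :
  ext_mx k.+1 h *m creation k i = \sum_c h c i *: (creation k c *m ext_mx k h).
Proof.
apply/matrixP => I J; rewrite ext_creation minor_laplace summxE.
transitivity (\sum_c \sum_(p < k.+1) h c i * ((-1) ^+ p * (mindex I p == c)%:R *
    minor h (mindex I \o lift p) (mindex J))); last first.
  apply: eq_bigr => c _; rewrite mxE -mulr_sumr; congr (_ * _).
  by rewrite (@creation_mul _ _ _ h _ _ _ (mindex J)) // => L; rewrite ext_mxE.
rewrite exchange_big; apply: eq_bigr => p _ /=.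
rewrite (bigD1 (mindex I p)) //= [X in _ + X]big1 ?addr0 => [|c /negbTE pc].
  by rewrite eqxx mulr1 mulrA [h _ _ * _]mulrC.
by rewrite eq_sym pc mulr0 mul0r mulr0.
Qed.

Lemma creationC k i j :
  creation k.+1 i *m creation k j = - (creation k.+1 j *m creation k i).
Proof.
have E c d I J : (creation k.+1 c *m creation k d) I J =
    minor 1%:M (mindex I) (fcons c (fcons d (mindex J))).
  rewrite minor_laplace (@creation_mul _ _ _ 1%:M _ _ _ (fcons d (mindex J))).
    by apply: eq_bigr => p _; rewrite mxE.
  by move=> L; rewrite mxE.
by apply/matrixP => I J; rewrite [RHS]mxE !E minor_fconsC.
Qed.

Lemma annihilation_creation k (I J : inc k) l c :
  ((creation k l)^T *m creation k c) I J =
  minor 1%:M (fcons l (mindex I)) (fcons c (mindex J)).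
Proof.
rewrite -minor_complete mxE; apply: eq_bigr => L _.
by rewrite !mxE minor1C.
Qed.

(** In exterior degree 0 the contraction of e_c with e_l has nothing else to contract. *)
Lemma anticommutation0 l c : (creation 0 l)^T *m creation 0 c = (1 *+ (c == l))%:M.
Proof.
apply/matrixP => I J; rewrite annihilation_creation minor_laplace big_ord_recl big_ord0.
rewrite addr0 expr0 mul1r !mxE fcons0 (@eq_minor _ _ _ (mindex I) _ (mindex J)) //; last first.
  by case.
by rewrite minor1_mindex mulr_natr eq_sym.
Qed.

Lemma mindex_lift k (I : inc k.+1) p : exists L : inc k, mindex L =1 mindex I \o lift p.
Proof.
apply: mindexP => q q' qq'; apply: mindex_lt => /=.
by rewrite /bump; case: (leqP p q) => pq; case: (leqP p q') => pq' //=; lia.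
Qed.

(** The canonical anticommutation relation between contraction by e_l and exterior
   multiplication by e_c: the first term of the Laplace expansion of
   det (e_l :: I, e_c :: J) is the contraction of e_c itself, the others contract
   e_c with I. *)
Lemma anticommutationS k l c : (creation k.+1 l)^T *m creation k.+1 c =
  (1 *+ (c == l))%:M - creation k c *m (creation k l)^T.
Proof.
apply/matrixP => I J; rewrite annihilation_creation minor_laplace big_ord_recl.
rewrite mxE [in RHS]mxE; congr (_ + _).
  rewrite expr0 mul1r !mxE fcons0 (@eq_minor _ _ _ (mindex I) _ (mindex J)) //; last first.
    by move=> p; rewrite /= fconsS.
  by rewrite minor1_mindex mulr_natr eq_sym.
rewrite !mxE -sumrN; under [RHS]eq_bigr => L _ do
  rewrite 2!mxE minor_laplace mulr_suml -sumrN.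
rewrite exchange_big; apply: eq_bigr => p _ /=.
have [L0 L0E] := mindex_lift I p.
rewrite (bigD1 L0) //= [X in _ + X]big1 ?addr0 => [|L LL0].
  rewrite (@eq_minor _ _ _ (mindex L0) _ (mindex L0)) // minor1_mindex eqxx mulr1.
  rewrite [creation _ _ _ _]mxE [in RHS]minor1C fconsS /bump add1n exprS.
  rewrite !mulN1r !mulNr; congr (- (_ * _)).
  apply: eq_minor => // q; rewrite /=; case: (unliftP ord0 q) => [q' ->|->].
    rewrite fconsS L0E /= -[RHS](fconsS l); congr (fcons _ _ _); apply: val_inj => /=.
    by rewrite /bump; lia.
  by rewrite fcons0 -[RHS](fcons0 l (mindex I)); congr (fcons _ _ _); apply: val_inj.
rewrite (@eq_minor _ _ _ (mindex L0) _ (mindex L)) // minor1_mindex.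
by rewrite eq_sym (negbTE LL0) mulr0 mul0r oppr0.
Qed.

Lemma creation_head k (I : inc k.+1) : exists L : inc k,
  forall J, creation k (mindex I ord0) J L = (J == I)%:R.
Proof.
have [L LI] := mindex_lift I ord0; exists L => J.
rewrite mxE (@eq_minor _ _ _ (mindex J) _ (mindex I)) ?minor1_mindex // => p.
by case: (unliftP ord0 p) => [p' ->|->]; rewrite ?fcons0 // fconsS LI.
Qed.

Lemma mul_creation_head k s (Z : 'M[K]_(s, #|increasing N k.+1|)) I L :
  (forall J, creation k (mindex I ord0) J L = (J == I)%:R) ->
  forall x, (Z *m creation k (mindex I ord0)) x L = Z x I.
Proof.
move=> LE x; rewrite mxE (bigD1 I) //= [X in _ + X]big1 ?addr0 => [|J JI];
  rewrite LE ?eqxx ?mulr1 //.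
by rewrite (negbTE JI) mulr0.
Qed.

(** Exterior multiplications reach every basis vector e_I, since
   e_I = e_(I_0) /\ e_(I_1, ..., I_k). *)
Lemma creation_cancel k s (Z : 'M[K]_(s, #|increasing N k.+1|)) :
  (forall i, Z *m creation k i = 0) -> Z = 0.
Proof.
move=> Z0; apply/matrixP => x I; have [L LE] := creation_head I.
by rewrite -(mul_creation_head Z LE) Z0 !mxE.
Qed.

End Minors.

(** * Derivations of exterior powers *)

Section ExtDerivation.
Variables (K : comNzRingType) (N : nat).
Implicit Types (X : 'M[K]_N) (k : nat).
Local Notation inc k := #|increasing N k|.

(** Second quantization of X: the derivation of the exterior power extending X, as
   sum_(c,l) X_cl e_c /\ (contraction by e_l). *)
Definition ext_der k X : 'M[K]_(inc k) :=
  if k is k'.+1 then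
    \sum_c \sum_l X c l *: (creation K k' c *m (creation K k' l)^T)
  else 0.

Lemma ext_der_creation k X i :
  ext_der k.+1 X *m creation K k i =
  \sum_c X c i *: creation K k c + creation K k i *m ext_der k X.
Proof.
have -> : ext_der k.+1 X *m creation K k i =
    \sum_c \sum_l X c l *: (creation K k c *m ((creation K k l)^T *m creation K k i)).
  rewrite mulmx_suml; apply: eq_bigr => c _; rewrite mulmx_suml; apply: eq_bigr => l _.
  by rewrite -scalemxAl mulmxA.
case: k => [|k].
  rewrite mulmx0 addr0; apply: eq_bigr => c _; rewrite (bigD1 i) //=.
  rewrite [X in _ + X]big1 ?addr0 => [|l /negbTE li].
    by rewrite anticommutation0 eqxx mulmx1.
  by rewrite anticommutation0 eq_sym li mulr0n raddf0 mulmx0 scaler0.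
rewrite mulmx_sumr -big_split; apply: eq_bigr => c _ /=.
have -> : X c i *: creation K k.+1 c =
    \sum_l X c l *: (creation K k.+1 c *m (1 *+ (i == l))%:M).
  rewrite (bigD1 i) //= [X in _ + X]big1 ?addr0 ?eqxx ?mulmx1 // => l /negbTE li.
  by rewrite eq_sym li mulr0n raddf0 mulmx0 scaler0.
rewrite mulmx_sumr -big_split; apply: eq_bigr => l _ /=.
rewrite anticommutationS mulmxBr scalerBr mulmxA creationC mulNmx scalerN opprK.
by rewrite -scalemxAr mulmxA.
Qed.

Lemma ext_der_row_blocks k X :
  ext_der k.+1 X *m row_blocks (creation K k) =
  row_blocks (creation K k) *m (X *t 1%:M + 1%:M *t ext_der k X).
Proof.
by apply/row_blocks_intertwine => i; exact: ext_der_creation.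
Qed.

(** Derivations compatible with exterior multiplication are determined recursively by
   their action in degree 0; this identifies logarithmic derivatives of exterior
   powers with [ext_der] and spares the differentiation of determinants. *)
Lemma ext_der_unique X (A : forall k, 'M[K]_(inc k)) :
  A 0 = 0 ->
  (forall k, A k.+1 *m row_blocks (creation K k) =
     row_blocks (creation K k) *m (X *t 1%:M + 1%:M *t A k)) ->
  forall k, A k = ext_der k X.
Proof.
move=> A0 AS; elim=> [//|k IH]; apply/eqP; rewrite -subr_eq0; apply/eqP.
apply: creation_cancel => i; rewrite mulmxBl; apply/eqP; rewrite subr_eq0; apply/eqP.
move: i; apply: row_blocks_inj; rewrite -!mul_row_blocks AS.
by rewrite ext_der_row_blocks IH.
Qed.

Lemma ext_mx_row_blocks k (h : 'M[K]_N) :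
  ext_mx k.+1 h *m row_blocks (creation K k) =
  row_blocks (creation K k) *m (h *t ext_mx k h).
Proof.
rewrite mul_row_blocks row_blocks_tens; apply: eq_row_blocks => i.
exact: ext_mx_intertwine.
Qed.

Lemma ext_mx0 (h : 'M[K]_N) : ext_mx 0 h = 1%:M.
Proof.
apply/matrixP => I J; rewrite ext_mxE; transitivity (minor (1%:M : 'M[K]_N) (mindex I) (mindex J)).
  by rewrite /minor !det_mx00.
by rewrite minor1_mindex mxE.
Qed.

(** The two sides satisfy the same recursion over the exterior degree, by
   [ext_mx_intertwine]. *)
Lemma ext_mxM k (g h : 'M[K]_N) : ext_mx k (g *m h) = ext_mx k g *m ext_mx k h.
Proof.
elim: k => [|k IH]; first by rewrite !ext_mx0 mulmx1.
apply/eqP; rewrite -subr_eq0; apply/eqP/creation_cancel => i.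
rewrite mulmxBl -mulmxA !ext_mx_intertwine mulmx_sumr IH.
apply/eqP; rewrite subr_eq0; apply/eqP.
under [RHS]eq_bigr => c _ do rewrite -scalemxAr mulmxA ext_mx_intertwine mulmx_suml scaler_sumr.
rewrite exchange_big; apply: eq_bigr => c _ /=.
rewrite mxE scaler_suml; apply: eq_bigr => d _.
by rewrite -!scalemxAl scalerA -mulmxA mulrC.
Qed.

Lemma ext_mx1 k : ext_mx k (1%:M : 'M[K]_N) = 1%:M.
Proof. by apply/matrixP => I J; rewrite ext_mxE minor1_mindex mxE. Qed.

Lemma card_increasing k : inc k = 'C(N, k).
Proof. exact: card_ltn_sorted_tuples. Qed.

End ExtDerivation.

Lemma map_creation (K L : comNzRingType) (f : {rmorphism K -> L}) N k i :
  map_mx f (creation K k i) = creation L k i :> 'M_(#|increasing N k.+1|, _).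
Proof.
apply/matrixP => I J; rewrite !mxE -det_map_mx; congr (\det _).
by apply/matrixP => p q; rewrite !mxE rmorph_nat.
Qed.

Lemma map_ext_der (K L : comNzRingType) (f : {rmorphism K -> L}) N k (X : 'M[K]_N) :
  map_mx f (ext_der k X) = ext_der k (map_mx f X).
Proof.
case: k => [|k]; first by rewrite map_mx0.
rewrite raddf_sum; apply: eq_bigr => c _; rewrite raddf_sum; apply: eq_bigr => l _ /=.
by rewrite map_mxZ map_mxM -map_trmx !map_creation mxE.
Qed.

(** The recursion that [mxtrace_wick] yields for exterior powers, where the traces of
   the positive powers of T' are zero and T'^0 has trace 'C(N, k'). *)
Fixpoint ext_coef (N k m : nat) : int :=
  if k is k'.+1 then
    ('C(N, k'))%:Z - \sum_(j < m.+1) ext_coef N k' j *+ 'C(m, j)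
  else 0.

(** Coefficientwise (1 + t)^N times the series of the (-1)^(j-1) j^m t^j: the binomial
   expansion of (i + 1)^m solves the recursion. *)
Lemma ext_coefE N k m :
  ext_coef N k m = \sum_(i < k) (-1) ^+ i * (i.+1 ^ m * 'C(N, k - i.+1))%N%:Z.
Proof.
elim: k m => [|k IH] m; first by rewrite big_ord0.
rewrite big_ord_recl mul1r /= exp1n mul1n subn1 /= -sumrN; congr (_ + _).
transitivity (\sum_(j < m.+1) \sum_(i < k)
    - ((-1) ^+ i * (i.+1 ^ j * 'C(N, k - i.+1))%N%:Z *+ 'C(m, j))).
  by apply: eq_bigr => j _; rewrite IH -sumrMnl -sumrN.
rewrite exchange_big; apply: eq_bigr => i _ /=.
rewrite /bump add1n exprS mulN1r mulNr sumrN; congr (- _).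
rewrite -[i.+2]add1n expnDn subSS.
under eq_bigr => j _ do rewrite -mulrnAr.
rewrite -mulr_sumr; congr (_ * _).
rewrite big_distrl /= -natz natr_sum; apply: eq_bigr => j _.
by rewrite exp1n mul1n -mulnA natrM -mulr_natl !natz.
Qed.

Section ExtWick.
Variables (F : numFieldType) (n N : nat) (a : 'I_n -> 'M[F]_N).
Local Notation K := (even_form F n).

(** The matrix X is arbitrary because the recursion replaces X by Y^(m-j) X. *)
Lemma mxtrace_ext_der k m (X : 'M[K]_N) :
  \tr (square_mx (fun j => ext_der k (a j)) ^+ m *m ext_der k X) =
  (ext_coef N k m)%:~R * \tr (square_mx a ^+ m *m X).
Proof.
elim: k m X => [|k IH] m X; first by rewrite mulmx0 raddf0 mul0r.
pose G c l : 'M[K]_(#|increasing N k|) :=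
  if k is k'.+1 return 'M_(#|increasing N k|)
  then creation K k' c *m (creation K k' l)^T else 0.
rewrite [ext_der k.+1 X]/ext_der.
rewrite (@mxtrace_wick _ _ _ _ (creation K k) (fun l => (creation K k l)^T) G 1 _
  (square_mx (fun j => ext_der k (a j))) (square_mx a)); last first.
- by move=> c l; rewrite /G; case: (k) => [|k']; rewrite ?anticommutation0 ?subr0 ?anticommutationS.
- rewrite -square_mx_tens -[row_blocks _]/(row_blocks (creation K k)).
  have <- : map_mx (@even_cst F n) (row_blocks (creation F k)) = row_blocks (creation K k)
      :> 'M_(#|increasing N k.+1|, N * #|increasing N k|).
    apply/matrixP => I z; rewrite mxE ![row_blocks _ _ _]mxE.
    by rewrite -(map_creation (@even_cst F n)) [RHS]mxE.
  by apply: square_mx_intertwine => j; exact: ext_der_row_blocks.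
have pairE Z : wick_pairing G Z = ext_der k Z.
  rewrite /wick_pairing /G /ext_der; case: (k) => [|k'] //=.
  by rewrite big1 // => c _; rewrite big1 // => l _; rewrite scaler0.
have Ej (j : 'I_m.+1) : \tr (square_mx (fun j => ext_der k (a j)) ^+ j *m
      wick_pairing G (square_mx a ^+ (m - j) *m X)) =
    (ext_coef N k j)%:~R * \tr (square_mx a ^+ m *m X).
  by rewrite pairE IH mulmxA -[_ *m _ ^+ (m - j)]exprD subnKC // -ltnS.
under eq_bigr => j _ do rewrite Ej mulrnBl.
rewrite sumrB rmorphB mulrBl; congr (_ - _).
  rewrite big_ord_recl big1 => [|j _]; last by rewrite mxtrace_square_power mulr0 mul0rn.
  by rewrite addr0 bin0 mulr1n mul1r subn0 expr0 mxtrace1 card_increasing mulrC.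
rewrite rmorph_sum mulr_suml; apply: eq_bigr => j _ /=.
by rewrite rmorphMn /= mulrnAl.
Qed.

Lemma mxtrace_odd_ext k m :
  \tr (one_form_mx (fun j => ext_der k (a j)) ^+ m.*2.+1) =
  (ext_coef N k m)%:~R *: \tr (one_form_mx a ^+ m.*2.+1).
Proof.
rewrite !mxtrace_odd_power scaler_sumr; apply: eq_bigr => j _.
rewrite map_ext_der mxtrace_ext_der scalerAr; congr (_ * _).
by rewrite rmorphM rmorph_int -scaler_int mulr_algl.
Qed.

End ExtWick.

(** * Clifford modules *)

Section Gamma.
Variable R : rcfType.
Local Notation C := R[i].
Local Notation s1 := (i_sigma1 R).
Local Notation s2 := (i_sigma2 R).
Local Notation s3 := (sigma3 R).

Lemma sqr_iC : ('i : C)%C * ('i)%C = -1.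
Proof. by rewrite -expr2 sqr_i. Qed.

Lemma sigma_relations :
  [/\ s1 *m s1 = - 1%:M, s2 *m s2 = - 1%:M & s3 *m s3 = 1%:M] /\
  [/\ s1 *m s2 = - (s2 *m s1), s1 *m s3 = - (s3 *m s1) & s2 *m s3 = - (s3 *m s2)].
Proof.
do !split; apply/matrixP => a b; rewrite !mxE !big_ord_recl !big_ord0 !mxE;
  case: a => [[|[|a]] // ia]; case: b => [[|[|b]] // ib]; rewrite -?val_eqE /=;
  rewrite ?expr0 ?expr1 ?sqr_iC
   ?(mulr0, mul0r, mulr1, mul1r, mulrN1, mulN1r, oppr0, opprK, addr0, add0r) //;
  rewrite ?(mulr0n, mulr1n, sqr_iC, oppr0, opprK) //.
Qed.

Lemma gamma_clifford k i j : (i <= k.*2)%N -> (j <= k.*2)%N ->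
  gamma R k i *m gamma R k j + gamma R k j *m gamma R k i = ((-2) *+ (i == j))%:M.
Proof.
have [[s11 s22 s33] [s12 s13 s23]] := sigma_relations.
have double p (x : 'M[C]_p) : x = - 1%:M -> x + x = (-2)%:M.
  by move=> ->; rewrite -opprD -raddfD -raddfN.
have cancel p (x y : 'M[C]_p) : x = - y -> x + y = 0 by move=> ->; rewrite addNr.
have tN p q (x : 'M[C]_p) (y : 'M[C]_q) : (- x) *t y = - (x *t y).
  by rewrite -scaleN1r tensmxZl scaleN1r.
elim: k i j => [|k IH] [|[|i]] [|[|j]] //= ik jk;
  rewrite ?mulr1n ?mulr0n ?raddf0.
- by apply: double; rewrite -scalar_mxM sqr_iC raddfN.
- by apply: double; rewrite tensmx_mul s11 mulmx1 tN tensmx11.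
- by apply: cancel; rewrite !tensmx_mul s12 tN.
- by apply: cancel; rewrite !tensmx_mul s13 mulmx1 mul1mx tN.
- by rewrite addrC; apply: cancel; rewrite !tensmx_mul s12 tN.
- by apply: double; rewrite tensmx_mul s22 mulmx1 tN tensmx11.
- by apply: cancel; rewrite !tensmx_mul s23 mulmx1 mul1mx tN.
- by rewrite addrC; apply: cancel; rewrite !tensmx_mul s13 mulmx1 mul1mx tN.
- by rewrite addrC; apply: cancel; rewrite !tensmx_mul s23 mulmx1 mul1mx tN.
rewrite !tensmx_mul s33 -tensmxDr IH ?eqSS //.
by case: (i == j); rewrite ?mulr0n ?raddf0 ?tensmx0 // mulr1n -!(scalemx1 _ (-2)) tensmxZr tensmx11.
Qed.

(** Schur's lemma for the spinor module: commuting with the first two generators makes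
   the four blocks of Z a scalar 2 x 2 matrix, and the remaining generators reduce
   the common diagonal block to the previous case. *)
Lemma gamma_schur k (Z : 'M[C]_(pow2 k)) :
  (forall j, (j < k.*2)%N -> gamma R k j *m Z = Z *m gamma R k j) ->
  exists c, Z = c%:M.
Proof.
elim: k Z => [|k IH] Z Zc; first by exists (Z 0 0); rewrite [LHS]mx11_scalar.
pose blk a b : 'M[C]_(pow2 k) := \matrix_(x, y) Z (mxtens_index (a, x)) (mxtens_index (b, y)).
have left (A : 'M[C]_2) (B : 'M[C]_(pow2 k)) a b x y :
    ((A *t B) *m Z) (mxtens_index (a, x)) (mxtens_index (b, y)) =
    (\sum_c A a c *: (B *m blk c b)) x y.
  rewrite mxE big_mxtens_index summxE; apply: eq_bigr => c _.
  rewrite !mxE mulr_sumr; apply: eq_bigr => w _.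
  by rewrite tensmxE mxE mulrA.
have right (A : 'M[C]_2) (B : 'M[C]_(pow2 k)) a b x y :
    (Z *m (A *t B)) (mxtens_index (a, x)) (mxtens_index (b, y)) =
    (\sum_c A c b *: (blk a c *m B)) x y.
  rewrite mxE big_mxtens_index summxE; apply: eq_bigr => c _.
  rewrite !mxE mulr_sumr; apply: eq_bigr => w _.
  by rewrite tensmxE mxE mulrCA.
have comm j (A : 'M[C]_2) (B : 'M[C]_(pow2 k)) a b : (j < k.+1.*2)%N ->
    gamma R k.+1 j = A *t B -> \sum_c A a c *: (B *m blk c b) = \sum_c A c b *: (blk a c *m B).
  move=> jk jAB; apply/matrixP => x y; rewrite -left -right -jAB.
  by rewrite Zc.
have o01 : lift ord0 ord0 = 1 :> 'I_2 by apply: val_inj.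
have sum2 (f : 'I_2 -> 'M[C]_(pow2 k)) : \sum_c f c = f 0 + f 1.
  by rewrite !big_ord_recl big_ord0 addr0 o01.
have i0 : ('i%C : C) != 0 by apply/eqP => /(congr1 (@complex.Im R)) /eqP; rewrite oner_eq0.
have [s1_00 s1_01 s1_10 s1_11] : [/\ s1 0 0 = 0, s1 0 1 = 'i%C, s1 1 0 = 'i%C & s1 1 1 = 0].
  by split; rewrite mxE.
have [s2_00 s2_01 s2_10] : [/\ s2 0 0 = 0, s2 0 1 = 1 & s2 1 0 = -1].
  by split; rewrite mxE /= ?expr0 ?expr1.
have comm2 m (A : 'M[C]_2) (B : 'M[C]_(pow2 k)) a b : (m < k.+1.*2)%N ->
    gamma R k.+1 m = A *t B ->
    A a 0 *: (B *m blk 0 b) + A a 1 *: (B *m blk 1 b) =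
    A 0 b *: (blk a 0 *m B) + A 1 b *: (blk a 1 *m B).
  move=> mk mAB; rewrite -(sum2 (fun c => A a c *: (B *m blk c b))).
  by rewrite -(sum2 (fun c => A c b *: (blk a c *m B))); exact: comm mAB.
have e01 : blk 1 0 = blk 0 1.
  apply: (scalerI i0); have := comm2 0 s1 1%:M 0 0 isT erefl.
  by rewrite s1_00 s1_01 s1_10 !scale0r !add0r mul1mx mulmx1.
have e11 : blk 1 1 = blk 0 0.
  apply: (scalerI i0); have := comm2 0 s1 1%:M 0 1 isT erefl.
  by rewrite s1_00 s1_01 s1_11 !scale0r add0r addr0 mul1mx mulmx1.
have e10 : blk 1 0 = - blk 0 1.
  have := comm2 1 s2 1%:M 0 0 isT erefl.
  by rewrite s2_00 s2_01 s2_10 !scale0r !add0r mul1mx mulmx1 scale1r scaleN1r.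
have b10 : blk 1 0 = 0.
  move: e10; rewrite -e01 => /eqP; rewrite -addr_eq0 -mulr2n -scaler_nat scaler_eq0.
  by rewrite pnatr_eq0 => /eqP.
have [|c Bc] := IH (blk 0 0).
  have [s3_00 s3_01 s3_10] : [/\ s3 0 0 = 1, s3 0 1 = 0 & s3 1 0 = 0].
    by split; rewrite mxE /= ?expr0.
  move=> m mk; have := comm2 m.+2 s3 (gamma R k m) 0 0; rewrite doubleS !ltnS.
  by move=> /(_ mk erefl); rewrite s3_00 s3_01 s3_10 !scale0r !addr0 !scale1r.
exists c; apply/matrixP => u v.
case: (mxtens_indexP u) => a x; case: (mxtens_indexP v) => b y.
have -> : Z (mxtens_index (a, x)) (mxtens_index (b, y)) = blk a b x y by rewrite mxE.
have a01 (d : 'I_2) : d = 0 \/ d = 1.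
  by case: d => [[|[|d]] // id]; [left | right]; apply: val_inj.
rewrite [RHS]mxE (can_eq (@mxtens_indexK _ _)) xpair_eqE.
case: (a01 a) => ->; case: (a01 b) => ->; rewrite ?e11 -?e01 ?b10 ?Bc !mxE //=.
Qed.

End Gamma.

Section CliffordWick.
Variables (K : comNzRingType) (d N : nat).
Hypothesis double_eq0 : forall x : K, x + x = 0 -> x = 0.
Variable g : 'I_N -> 'M[K]_d.
Hypothesis g_clifford :
  forall c l, g l *m g c = ((- 2) *+ (c == l))%:M - g c *m g l.

(** The spin representation of so(N): up to the factor -1/4, an antisymmetric X acts
   on generators by sum_(c,l) X_cl g_c g_l. *)
Lemma quadratic_commutator (X : 'M[K]_N) i : X^T = - X ->
  (\sum_c \sum_l X c l *: (g c *m g l)) *m g i =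
  g i *m (\sum_c \sum_l X c l *: (g c *m g l)) - 4 *: \sum_c X c i *: g c.
Proof.
move=> XT; have Xa c l : X c l = - X l c by have := congr1 (fun A : 'M_N => A l c) XT; rewrite !mxE.
pose D := \sum_c \sum_l X c l *: ((-2 *+ (i == l)) *: g c).
pose E := \sum_c \sum_l X c l *: ((-2 *+ (i == c)) *: g l).
have DE : D = - 2 *: \sum_c X c i *: g c.
  rewrite scaler_sumr; apply: eq_bigr => c _; rewrite (bigD1 i) //=.
  rewrite [X in _ + X]big1 ?addr0 => [|l /negbTE li].
    by rewrite eqxx mulr1n !scalerA mulrC.
  by rewrite eq_sym li mulr0n scale0r scaler0.
have EE : E = 2 *: \sum_c X c i *: g c.
  rewrite /E (bigD1 i) //= [X in _ + X]big1 ?addr0 => [|c /negbTE ci].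
    rewrite scaler_sumr; apply: eq_bigr => l _.
    by rewrite eqxx mulr1n Xa !scalerA mulNr mulrN opprK mulrC.
  by rewrite big1 // => l _; rewrite eq_sym ci mulr0n scale0r scaler0.
transitivity (g i *m (\sum_c \sum_l X c l *: (g c *m g l)) + (D - E)); last first.
  by rewrite DE EE -scalerBl -scaleNr; congr (_ + _ *: _); ring.
rewrite mulmx_suml mulmx_sumr -sumrB -big_split; apply: eq_bigr => c _ /=.
rewrite mulmx_suml mulmx_sumr -sumrB -big_split; apply: eq_bigr => l _ /=.
rewrite -scalemxAl -scalemxAr -scalerBr -scalerDr; congr (_ *: _).
rewrite -mulmxA g_clifford mulmxBr mul_mx_scalar !mulmxA.
rewrite [g c *m g i]g_clifford mulmxBl mul_scalar_mx -mulmxA.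
by rewrite opprB addrCA addrA addrAC.
Qed.

Section Recursion.
Variables (S : 'M[K]_d) (Y : 'M[K]_N).
Hypothesis S_g : S *m row_blocks g = row_blocks g *m (Y *t 1%:M + 1%:M *t S).
Hypothesis S_trace : forall m, \tr (S ^+ m.+1) = 0.

Let W m (X : 'M[K]_N) : K :=
  \tr (S ^+ m *m \sum_c \sum_l X c l *: (g c *m g l)).

(** [mxtrace_wick] with creation and annihilation operators both equal to the g_c. The
   term j = m of the recursion contains - W m X, whence the sum on the left. *)
Lemma spin_wick m (X : 'M[K]_N) :
  W m X + W m X = - (\tr (Y ^+ m *m X) *+ (2 * d)) -
    \sum_(j < m) W j (Y ^+ (m - j) *m X) *+ 'C(m, j).
Proof.
pose G c l := g c *m g l.
have := @mxtrace_wick _ _ _ _ g g G (-2) S S Y X m S_g g_clifford.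
rewrite -/(W m X) => WE; rewrite {1}WE.
under eq_bigr => j _ do rewrite mulrnBl.
rewrite sumrB big_ord_recl big1 => [|j _]; last by rewrite S_trace mulr0 mul0rn.
rewrite big_ord_recr /= subnn expr0 mul1mx binn mulr1n -/(W m X) bin0 mulr1n subn0 mxtrace1.
rewrite addr0 [X in _ + X + _]opprD addrA addrNK; congr (_ - _).
by rewrite !mulNr mulr_natr mulr_natl mulrnA.
Qed.

Let double_inj (x y : K) : x + x = y + y -> x = y.
Proof.
move=> e; apply/eqP; rewrite -subr_eq0; apply/eqP/double_eq0.
by rewrite addrACA -opprD e subrr.
Qed.

Lemma spin_wick0 X : W 0 X = - (\tr X *+ d).
Proof.
apply: double_inj; rewrite spin_wick big_ord0 subr0 expr0 mul1mx.
by rewrite mulnC mulrnA mulr2n opprD.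
Qed.

Lemma spin_wick1 X : W 1 X + W 1 X = - (\tr (Y *m X) *+ d).
Proof.
rewrite spin_wick big_ord_recl big_ord0 /= subn0 expr1 bin0 mulr1n spin_wick0.
by rewrite addr0 opprK mul2n -addnn mulrnDr opprD addrNK.
Qed.

Lemma spin_wick2 X : W 2 X = 0.
Proof.
apply: double_eq0; rewrite spin_wick !big_ord_recl big_ord0 /= subn0 addr0 !bin0 mulr1n.
rewrite spin_wick0 mulr2n spin_wick1 mulmxA -[Y *m _]exprS mul2n -addnn mulrnDr.
by rewrite -!opprD subrr oppr0.
Qed.

Lemma spin_wick3 X : W 3 X *+ 4 = \tr (Y ^+ 3 *m X) *+ d.
Proof.
have e3 := spin_wick 3 X.
move: e3; rewrite !big_ord_recl big_ord0 /= subn0 addr0 !bin0 mulr1n.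
rewrite spin_wick0 spin_wick2 mul0rn addr0.
set t := \tr _; have := spin_wick1 (Y ^+ 2 *m X).
rewrite mulmxA -[_ *m _ ^+ 2]exprS -/t => e1 e3.
move: e3 e1; rewrite /bump /= mulnC mulrnA.
set u := t *+ d; set w := W 1 _; set v := W 3 X => e3 e1.
rewrite (_ : 'C(3, 1 + 0) = 3%N) // in e3.
have -> : v *+ 4 = (v + v) + (v + v) by ring.
(* 4 v = - 2 u - 6 w and 2 w = - u *)
rewrite e3; transitivity (- (u + u) - (w + w) *+ 3); first by rewrite /=; ring.
by rewrite e1; ring.
Qed.

End Recursion.

End CliffordWick.

Lemma spin_rep_commute (K : numFieldType) d N (g : 'I_N -> 'M[K]_d)
    (s : 'M[K]_d) (X : 'M[K]_N) i :
  (forall c l, g l *m g c = ((- 2) *+ (c == l))%:M - g c *m g l) ->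
  X^T = - X ->
  (forall i, s *m g i = \sum_c X c i *: g c + g i *m s) ->
  let Q := (- 4^-1) *: \sum_c \sum_l X c l *: (g c *m g l) in
  g i *m (s - Q) = (s - Q) *m g i.
Proof.
move=> g_clifford XT sg Q.
rewrite mulmxBl mulmxBr sg /Q -scalemxAl -scalemxAr (quadratic_commutator g_clifford) //.
rewrite scalerBr !scaleNr scalerA mulVf ?pnatr_eq0 // scale1r.
by rewrite opprB opprK addrACA subrr add0r.
Qed.

(** The scalar z contributes a multiple of the trace of a positive power of the
   square, which is zero. *)
Lemma mxtrace_spin_rep (F : numFieldType) n d N (g : 'I_N -> 'M[F]_d)
    (s : 'I_n -> 'M[F]_d) m (X : 'M[F]_N) (Z : 'M[F]_d) (z : F) : (0 < m)%N ->
  Z = (- 4^-1) *: (\sum_c \sum_l X c l *: (g c *m g l)) + z%:M ->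
  let f := @even_cst F n in let gK c := map_mx f (g c) in
  \tr (square_mx s ^+ m *m map_mx f Z) *+ 4 =
  - \tr (square_mx s ^+ m *m \sum_c \sum_l map_mx f X c l *: (gK c *m gK l)).
Proof.
case: m => [//|m] _ -> f gK; rewrite map_mxD map_scalar_mx mulmxDr mul_mx_scalar raddfD /=.
rewrite mxtraceZ mxtrace_square_power mulr0 addr0 map_mxZ -scalemxAr mxtraceZ.
rewrite -mulrnAl -rmorphMn -mulr_natr mulNr mulVf ?pnatr_eq0 // rmorphN rmorph1 mulN1r.
congr (- \tr (_ *m _)); rewrite raddf_sum; apply: eq_bigr => c _.
by rewrite raddf_sum; apply: eq_bigr => l _ /=; rewrite map_mxZ map_mxM mxE.
Qed.

Section SpinTraces.
Variables (F : numFieldType) (n d N : nat) (g : 'I_N -> 'M[F]_d).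
Hypothesis g_clifford :
  forall c l, g l *m g c = ((- 2) *+ (c == l))%:M - g c *m g l.
Hypothesis g_schur : forall Z, (forall j, g j *m Z = Z *m g j) -> exists z, Z = z%:M.
Variables (a : 'I_n -> 'M[F]_N) (s : 'I_n -> 'M[F]_d).
Hypothesis a_antisym : forall j, (a j)^T = - a j.
Hypothesis s_g : forall j,
  s j *m row_blocks g = row_blocks g *m (a j *t 1%:M + 1%:M *t s j).
Local Notation K := (even_form F n).
Let f := @even_cst F n.
Let gK c : 'M[K]_d := map_mx f (g c).

(** An operator acting on the generators like a_j differs from the quadratic
   expression by something that commutes with all generators. *)
Lemma spin_rep_unique j : exists z : F,
  s j = (- 4^-1) *: (\sum_c \sum_l a j c l *: (g c *m g l)) + z%:M.
Proof.
have [i|z Zz] := g_schur (Z := s j - (- 4^-1) *: (\sum_c \sum_l a j c l *: (g c *m g l))).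
  by apply: spin_rep_commute => //; apply/row_blocks_intertwine.
by exists z; rewrite -Zz addrC subrK.
Qed.

Let gK_clifford c l : gK l *m gK c = ((- 2) *+ (c == l))%:M - gK c *m gK l.
Proof.
by rewrite /gK -!map_mxM g_clifford map_mxB map_scalar_mx /= rmorphMn rmorphN rmorph_nat.
Qed.

Let S_gK : square_mx s *m row_blocks gK =
  row_blocks gK *m (square_mx a *t 1%:M + 1%:M *t square_mx s).
Proof.
rewrite -square_mx_tens.
have <- : map_mx f (row_blocks g) = row_blocks gK by apply/matrixP => x z; rewrite !mxE.
exact: square_mx_intertwine.
Qed.

Let S_trace m : \tr (square_mx s ^+ m.+1) = 0.
Proof. exact: mxtrace_square_power. Qed.

Let trace_rep m j : (0 < m)%N -> \tr (square_mx s ^+ m *m map_mx f (s j)) *+ 4 =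
  - \tr (square_mx s ^+ m *m \sum_c \sum_l map_mx f (a j) c l *: (gK c *m gK l)).
Proof.
by move=> m0; have [z sz] := spin_rep_unique j; exact: mxtrace_spin_rep m0 sz.
Qed.

Let dbl := @even_double_eq0 F n.

Lemma mxtrace_odd_spin3 : \tr (one_form_mx s ^+ 3) *+ 8 = \tr (one_form_mx a ^+ 3) *+ d.
Proof.
rewrite -[3%N]/(1.*2.+1) !mxtrace_odd_power -!sumrMnl; apply: eq_bigr => j _.
rewrite -!mulrnAr -!rmorphMn; congr (_ * ev_val _).
rewrite (_ : 8 = 4 * 2)%N // mulrnA trace_rep // mulNrn mulr2n.
by rewrite (spin_wick1 dbl gK_clifford S_gK S_trace) opprK expr1.
Qed.

Lemma mxtrace_odd_spin5 : \tr (one_form_mx s ^+ 5) = 0.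
Proof.
rewrite -[5%N]/(2.*2.+1) mxtrace_odd_power big1 // => j _.
have := @trace_rep 2 j isT; rewrite (spin_wick2 dbl gK_clifford S_gK S_trace) oppr0.
rewrite (_ : 4 = 2 * 2)%N // mulrnA mulr2n => /dbl.
by rewrite mulr2n => /dbl ->; rewrite rmorph0 mulr0.
Qed.

(** The factor 16 is 4 from the spin representation times 4 from [spin_wick3]. *)
Lemma mxtrace_odd_spin7 :
  \tr (one_form_mx s ^+ 7) *+ 16 = - (\tr (one_form_mx a ^+ 7) *+ d).
Proof.
rewrite -[7%N]/(3.*2.+1) !mxtrace_odd_power -!sumrMnl -sumrN; apply: eq_bigr => j _.
rewrite -!mulrnAr -mulrN -!rmorphMn -rmorphN; congr (_ * ev_val _).
rewrite (_ : 16 = 4 * 4)%N // mulrnA trace_rep // mulNrn.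
by rewrite (spin_wick3 dbl gK_clifford S_gK S_trace).
Qed.

End SpinTraces.

Section GammaBasis.
Variables (R : rcfType) (N : nat).
Hypothesis N_even : ~~ odd N.
Local Notation C := R[i].

Definition clifford_gen (j : 'I_N) : 'M[C]_(spin_rank N) := gamma R N./2 j.

Lemma clifford_gen_anticommute c l :
  clifford_gen l *m clifford_gen c = ((- 2) *+ (c == l))%:M - clifford_gen c *m clifford_gen l.
Proof.
apply/eqP; rewrite eq_sym subr_eq eq_sym; apply/eqP.
have le (j : 'I_N) : (j <= N./2.*2)%N by rewrite even_halfK // ltnW.
by rewrite gamma_clifford // eq_sym.
Qed.

Lemma clifford_gen_schur (Z : 'M[C]_(spin_rank N)) :
  (forall j, clifford_gen j *m Z = Z *m clifford_gen j) -> exists z, Z = z%:M.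
Proof.
move=> Zc; apply: gamma_schur => j; rewrite even_halfK // => jN.
exact: (Zc (Ordinal jN)).
Qed.

End GammaBasis.

(** * Power series of virtual bundles *)

Section Convolution.
Variable A : nzRingType.
Implicit Types (x y z m : nat -> A) (k : nat).

Definition convolve x y k : A := \sum_(i < k.+1) x i * y (k - i)%N.

(** Makes associativity of convolution that of polynomial multiplication: the
   coefficient k only sees the truncations at any degree b > k. *)
Lemma convolve_poly x y k b : (k < b)%N ->
  (\poly_(i < b) x i * \poly_(i < b) y i)`_k = convolve x y k.
Proof.
move=> kb; rewrite coefM; apply: eq_bigr => i _.
have ik : (i <= k)%N by rewrite -ltnS.
by rewrite !coef_poly (leq_ltn_trans ik kb) (leq_ltn_trans (leq_subr i k) kb).
Qed.

Lemma convolveA x y z k : convolve (convolve x y) z k = convolve x (convolve y z) k.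
Proof.
pose p u := \poly_(i < k.+1) (u i : A).
transitivity ((p x * p y * p z)`_k).
  rewrite coefM; apply: eq_bigr => i _; have ik := ltn_ord i.
  by rewrite convolve_poly // coef_poly ltnS leq_subr.
rewrite -mulrA coefM; apply: eq_bigr => i _; have ik := ltn_ord i.
by rewrite convolve_poly ?ltnS ?leq_subr // coef_poly ik.
Qed.

Lemma convolve1 x k : convolve x (fun j => (j == 0)%:R) k = x k.
Proof.
rewrite /convolve big_ord_recr /= subnn eqxx mulr1 big1 ?add0r // => i _.
by rewrite subn_eq0 leqNgt ltn_ord mulr0.
Qed.

Lemma convolve1l x k : convolve (fun j => (j == 0)%:R) x k = x k.
Proof.
rewrite /convolve big_ord_recl mul1r subn0 big1 ?addr0 // => i _.
by rewrite mul0r.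
Qed.

Lemma eq_convolve x x' y y' k :
  (forall j, (j <= k)%N -> x j = x' j) -> (forall j, (j <= k)%N -> y j = y' j) ->
  convolve x y k = convolve x' y' k.
Proof.
move=> ex ey; apply: eq_bigr => i _; rewrite ex ?ey ?leq_subr //.
by rewrite -ltnS.
Qed.

End Convolution.

Section Evaluation.
Variables (T : tensor_ops) (A : nzRingType) (f : bundle T -> A) (P : bundle T -> Prop).
Hypothesis P_trivial : forall m, P (trivial T m).
Hypothesis P_tensor : forall V W, P V -> P W -> P (tensor V W).
Hypothesis P_ext : forall k W, P W -> P (ext k W).
Hypothesis f_tensor : forall V W, P V -> P W -> f (tensor V W) = f V * f W.
Hypothesis f_trivial1 : f (trivial T 1) = 1.
Implicit Types (V W : virtual T) (a b : vseries T).
Local Notation phi := (additive_ext f).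

(** Multiplicativity of f is available only for some bundles; this says that all
   bundles occurring in a formal difference are of that kind. *)
Fixpoint all_bundles V : Prop := if V is v :: V' then P v.2 /\ all_bundles V' else True.

Lemma all_bundles_add V W : all_bundles V -> all_bundles W -> all_bundles (vadd V W).
Proof. by elim: V => //= v V IH [Pv /IH IHV] /IHV. Qed.

Lemma all_bundles_opp V : all_bundles V -> all_bundles (vopp V).
Proof. by elim: V => //= v V IH [Pv /IH]. Qed.

Lemma all_bundles_muln V k : all_bundles V -> all_bundles (vmuln V k).
Proof. by move=> PV; elim: k => //= k IH; apply: all_bundles_add. Qed.

Lemma all_bundles_tensor V W : all_bundles V -> all_bundles W -> all_bundles (vtensor V W).
Proof.
move=> PV PW; elim: V PV => //= v V IH [Pv /IH IHV]; apply: all_bundles_add => // {IH IHV}.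
by elim: W PW => //= w W IH [Pw /IH IHW]; split=> //; exact: P_tensor.
Qed.

Lemma all_bundles_flatten (I : Type) (s : seq I) (F : I -> virtual T) :
  (forall i, all_bundles (F i)) -> all_bundles (flatten [seq F i | i <- s]).
Proof. by move=> PF; elim: s => //= i s IH; exact: all_bundles_add. Qed.

Lemma all_bundles_reduced (W : bundle T) : P W -> all_bundles (reduced W).
Proof. by move=> PW; split=> //; split=> //; exact: P_trivial. Qed.

Lemma additive_ext0 : phi [::] = 0.
Proof. exact: big_nil. Qed.

Lemma additive_ext_bundle (W : bundle T) : phi (vbundle W) = f W.
Proof. by rewrite /additive_ext big_seq1 expr0 mul1r. Qed.

Lemma additive_ext_add V W : phi (vadd V W) = phi V + phi W.
Proof. exact: big_cat. Qed.

Lemma additive_ext_opp V : phi (vopp V) = - phi V.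
Proof.
rewrite /additive_ext big_map -sumrN; apply: eq_bigr => v _ /=.
by case: v.1; rewrite !(expr0, expr1, mul1r, mulN1r, opprK).
Qed.

Lemma additive_ext_muln V k : phi (vmuln V k) = phi V *+ k.
Proof. by elim: k => [|k IH]; rewrite ?additive_ext0 // mulrS -IH -additive_ext_add. Qed.

Lemma additive_ext_tensor V W : all_bundles V -> all_bundles W -> phi (vtensor V W) = phi V * phi W.
Proof.
move=> PV PW; elim: V PV => [|v V IH] /=; first by rewrite !additive_ext0 mul0r.
move=> [Pv PV]; rewrite {2}/additive_ext big_cons mulrDl -/(phi V) -IH //.
rewrite -[vtensor (v :: V) W]/(vadd _ (vtensor V W)) additive_ext_add; congr (_ + _).
rewrite /additive_ext big_map mulr_sumr.
elim: W PW {IH PV} => [|w W IH] /=; rewrite ?big_nil // !big_cons => -[Pw PW].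
rewrite IH //= f_tensor // -!mulrA; congr (_ + _).
by rewrite signr_addb -!mulrA; congr (_ * _); rewrite !mulrA -commr_sign.
Qed.

Lemma additive_ext_reduced (W : bundle T) : phi (reduced W) = f W - f (trivial T (rank W)).
Proof. by rewrite additive_ext_add additive_ext_opp !additive_ext_bundle. Qed.

Lemma additive_ext_flatten (I : Type) (s : seq I) (F : I -> virtual T) :
  phi (flatten [seq F i | i <- s]) = \sum_(i <- s) phi (F i).
Proof.
elim: s => [|i s IH]; first by rewrite big_nil additive_ext0.
by rewrite big_cons -IH -additive_ext_add.
Qed.

Lemma all_bundles_vsmul a b : (forall k, all_bundles (a k)) -> (forall k, all_bundles (b k)) ->
  forall k, all_bundles (vsmul a b k).
Proof. by move=> Pa Pb k; apply: all_bundles_flatten => i; exact: all_bundles_tensor. Qed.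

Lemma additive_ext_vsmul a b k : (forall k, all_bundles (a k)) -> (forall k, all_bundles (b k)) ->
  phi (vsmul a b k) = convolve (phi \o a) (phi \o b) k.
Proof.
move=> Pa Pb; rewrite additive_ext_flatten -val_enum_ord big_map big_enum /=.
by apply: eq_bigr => i _; rewrite additive_ext_tensor.
Qed.

Lemma size_vsinv_seq a k : size (vsinv_seq a k) = k.+1.
Proof. by elim: k => //= k IH; rewrite size_rcons IH. Qed.

Lemma nth_vsinv_seq a k i : (i <= k)%N -> nth [::] (vsinv_seq a k) i = vsinv a i.
Proof.
elim: k => [|k IH]; first by rewrite leqn0 => /eqP ->.
rewrite leq_eqVlt => /predU1P[-> //|]; rewrite ltnS => ik.
by rewrite /= nth_rcons size_vsinv_seq ltnS ik IH.
Qed.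

Lemma vsinvS a k : vsinv a k.+1 =
  vopp (flatten [seq vtensor (a (k.+1 - i)%N) (vsinv a i) | i <- iota 0 k.+1]).
Proof.
rewrite {1}/vsinv -[vsinv_seq a k.+1]/(rcons (vsinv_seq a k) (vopp (flatten
  [seq vtensor (a (k.+1 - i)%N) (nth [::] (vsinv_seq a k) i) | i <- iota 0 k.+1]))).
rewrite nth_rcons size_vsinv_seq ltnn eqxx.
congr (vopp (flatten _)); apply/eq_in_map => j; rewrite mem_iota add0n => /andP[_ jk].
by rewrite nth_vsinv_seq.
Qed.

Lemma all_bundles_vsinv a : (forall k, all_bundles (a k)) -> forall k, all_bundles (vsinv a k).
Proof.
move=> Pa k; have [b] := ubnP k; elim: b k => // b IH [_|k kb].
  by split=> //; exact: P_trivial.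
rewrite vsinvS; apply: all_bundles_opp.
have : all (fun i => (i <= k)%N) (iota 0 k.+1).
  by apply/allP => i; rewrite mem_iota.
elim: (iota 0 k.+1) => //= i s IHs /andP[ik sk]; apply: all_bundles_add; last exact: IHs.
by apply: all_bundles_tensor => //; apply: IH; exact: leq_ltn_trans ik kb.
Qed.

Lemma additive_ext_vsinv0 a : phi (vsinv a 0) = 1.
Proof. by rewrite additive_ext_bundle. Qed.

Lemma additive_ext_vsinv a k : (forall k, all_bundles (a k)) -> phi (a 0) = 1 ->
  convolve (phi \o a) (phi \o vsinv a) k = (k == 0)%:R.
Proof.
move=> Pa a0; case: k => [|k].
  by rewrite /convolve big_ord_recl big_ord0 addr0 /= additive_ext_vsinv0 a0 mulr1.
rewrite /convolve big_ord_recl /= a0 mul1r subn0 vsinvS additive_ext_opp additive_ext_flatten.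
rewrite -val_enum_ord big_map big_enum /= [X in - X](reindex_inj rev_ord_inj) /=.
rewrite addrC; apply/eqP; rewrite subr_eq0; apply/eqP; apply: eq_bigr => i _.
rewrite additive_ext_tensor //; last exact: all_bundles_vsinv.
have ik : (i <= k)%N by rewrite -ltnS.
by rewrite /= /bump add1n !subSS subSn ?leq_subr // subKn.
Qed.

Lemma additive_ext_vs1 k : phi (vs1 T k) = (k == 0)%:R.
Proof. by case: k => [|k]; rewrite ?additive_ext0 // additive_ext_bundle. Qed.

Lemma all_bundles_vs1 k : all_bundles (vs1 T k).
Proof. by case: k => [|k] //; split=> //; exact: P_trivial. Qed.

Lemma all_bundles_wedge_series V : all_bundles V -> forall k, all_bundles (wedge_series V k).
Proof.
elim: V => [|v V IH] /=; first by move=> _; exact: all_bundles_vs1.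
move=> [Pv PV]; apply: all_bundles_vsmul; last exact: IH.
have Pe k : all_bundles (vbundle (ext k v.2)) by split=> //; exact: P_ext.
by case: v.1 => //; exact: all_bundles_vsinv.
Qed.

Lemma all_bundles_vwedge k V : all_bundles V -> all_bundles (vwedge k V).
Proof. by move=> PV; exact: all_bundles_wedge_series. Qed.

Lemma all_bundles_vsym k V : all_bundles V -> all_bundles (vsym k V).
Proof.
move=> PV; apply: all_bundles_vsinv => j; have Pj := all_bundles_vwedge j PV.
by case: ifP => // _; exact: all_bundles_opp.
Qed.

(** Lambda_t(W - C^r) = Lambda_t(W) / (1 + t)^r: a factorization of the series of W
   with factor (1 + t)^r has the series of the reduced bundle as quotient. *)
Lemma additive_ext_vwedge_reduced (W : bundle T) (m : nat -> A) k : P W ->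
  (forall j, f (ext j (trivial T (rank W))) = ('C(rank W, j))%:R) ->
  (forall j, f (ext j W) = convolve m (fun l => ('C(rank W, l))%:R) j) ->
  phi (vwedge k (reduced W)) = m k.
Proof.
move=> PW ftriv fW.
pose t : vseries T := fun j => vbundle (ext j (trivial T (rank W))).
pose w : vseries T := fun j => vbundle (ext j W).
have Pt j : all_bundles (t j) by split=> //; apply: P_ext; exact: P_trivial.
have Pw j : all_bundles (w j) by split=> //; exact: P_ext.
have Pinv := all_bundles_vsinv Pt.
have t0 : phi (t 0) = 1 by rewrite additive_ext_bundle ftriv bin0.
rewrite -[vwedge k (reduced W)]/(vsmul w (vsmul (vsinv t) (vs1 T)) k).
rewrite additive_ext_vsmul //; last by apply: all_bundles_vsmul => //; exact: all_bundles_vs1.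
transitivity (convolve (convolve m (phi \o t)) (phi \o vsinv t) k).
  apply: eq_convolve => j _ /=.
    rewrite additive_ext_bundle fW; apply: eq_convolve => l _ //=.
    by rewrite additive_ext_bundle ftriv.
  rewrite additive_ext_vsmul //; last exact: all_bundles_vs1.
  rewrite -[RHS](convolve1 (phi \o vsinv t)); apply: eq_convolve => l _ //=.
  exact: additive_ext_vs1.
rewrite convolveA -[RHS]convolve1; apply: eq_convolve => j _ //.
exact: additive_ext_vsinv.
Qed.

(** If Lambda_(-t)(V) is the series 1, then so is its inverse S_t(V). *)
Lemma additive_ext_vsym k V : all_bundles V ->
  (forall j, phi (vwedge j V) = (j == 0)%:R) -> phi (vsym k V) = (k == 0)%:R.
Proof.
move=> PV wV; pose a : vseries T := fun j => if odd j then vopp (vwedge j V) else vwedge j V.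
have Pa j : all_bundles (a j).
  have Pj := all_bundles_vwedge j PV.
  by rewrite /a; case: ifP => // _; exact: all_bundles_opp.
have aE j : phi (a j) = (j == 0)%:R.
  rewrite /a; case: ifP => [jo|_]; rewrite ?additive_ext_opp wV //.
  by case: j jo => // j _; rewrite oppr0.
rewrite -(additive_ext_vsinv k Pa) ?aE // -[LHS](convolve1l (phi \o vsinv a)).
by apply: eq_convolve => j _ //=; rewrite aE.
Qed.

Lemma all_bundles_B1 V : all_bundles V -> all_bundles (B1 V).
Proof.
move=> PV; apply: all_bundles_add => //; apply: all_bundles_add; last first.
  exact/all_bundles_opp/all_bundles_tensor.
exact/all_bundles_muln/all_bundles_vwedge.
Qed.

Lemma additive_ext_B1 V : all_bundles V ->
  phi (B1 V) = phi (vwedge 2 V) *+ 2 - phi V * phi V + phi V.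
Proof.
move=> PV; rewrite /B1 2!additive_ext_add additive_ext_opp additive_ext_muln.
by rewrite additive_ext_tensor.
Qed.

Lemma all_bundles_B2 V : all_bundles V -> all_bundles (B2 V).
Proof.
move=> PV; have Pw k := all_bundles_vwedge k PV.
apply: all_bundles_add => //; apply: all_bundles_add => //; apply: all_bundles_add; last first.
  by apply/all_bundles_opp/all_bundles_tensor => //; exact: all_bundles_tensor.
apply: all_bundles_add; last exact/all_bundles_muln/all_bundles_tensor.
apply: all_bundles_add; last exact/all_bundles_opp/all_bundles_muln/all_bundles_tensor.
apply: all_bundles_add; first exact: all_bundles_tensor.
exact: all_bundles_muln.
Qed.

Lemma additive_ext_B2 V : all_bundles V ->
  phi (B2 V) = phi (vwedge 2 V) * phi (vwedge 2 V) + phi (vwedge 4 V) *+ 2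
    - (phi V * phi (vwedge 3 V)) *+ 2 + (phi V * phi (vwedge 2 V)) *+ 2
    - phi V * phi V * phi V + phi V + phi (vwedge 2 V).
Proof.
move=> PV; have Pw k := all_bundles_vwedge k PV.
rewrite /B2 6!additive_ext_add 2!additive_ext_opp 3!additive_ext_muln.
by rewrite !additive_ext_tensor //; exact: all_bundles_tensor.
Qed.

End Evaluation.

From mathcomp Require Import all_classical all_reals all_analysis.
Import numFieldNormedType.Exports.

(** * Partial derivatives of complex matrix functions *)

Section RealDerivative.
Variables (R : realType) (n : nat) (x v : 'rV[R]_n).
Implicit Types f g : 'rV[R]_n -> R.

Lemma is_derive_ext f g a b :
  is_derive x v f a -> f =1 g -> a = b -> is_derive x v g b.
Proof. by move=> fd /funext <- <-. Qed.

Lemma is_derive_add f g a b : is_derive x v f a -> is_derive x v g b ->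
  is_derive x v (fun y => f y + g y) (a + b).
Proof. by move=> fd gd; apply: (is_derive_ext (is_deriveD fd gd)). Qed.

Lemma is_derive_opp f a : is_derive x v f a -> is_derive x v (fun y => - f y) (- a).
Proof. by move=> fd; apply: (is_derive_ext (is_deriveN fd)). Qed.

Lemma is_derive_mul f g a b : is_derive x v f a -> is_derive x v g b ->
  is_derive x v (fun y => f y * g y) (a * g x + f x * b).
Proof.
move=> fd gd; apply: (is_derive_ext (is_deriveM fd gd)) => //.
by rewrite /GRing.scale /= addrC mulrC.
Qed.

End RealDerivative.

Section ComplexPartial.
Variables (R : realType) (n : nat) (k : 'I_n) (x : 'rV[R]_n).
Local Notation C := R[i].
Local Notation v := (delta_mx 0 k : 'rV[R]_n).
Implicit Types f g : 'rV[R]_n -> C.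

(** Derivability and value together, as they propagate through sums and products by
   the same computation. *)
Definition has_cpartial f (z : C) : Prop :=
  is_derive x v (fun y => complex.Re (f y)) (complex.Re z) /\
  is_derive x v (fun y => complex.Im (f y)) (complex.Im z).

Definition cderivable f : Prop :=
  derivable (fun y => complex.Re (f y)) x v /\
  derivable (fun y => complex.Im (f y)) x v.

Lemma cderivableP f : cderivable f -> has_cpartial f (cpartial k f x).
Proof. by case=> fr fi; split; exact: derivableP. Qed.

Lemma has_cpartial_derivable f z : has_cpartial f z -> cderivable f.
Proof.
case=> fr fi; split; first exact: (@ex_derive _ _ _ _ _ _ _ fr).
exact: (@ex_derive _ _ _ _ _ _ _ fi).
Qed.

Lemma has_cpartialE f z : has_cpartial f z -> cpartial k f x = z.
Proof.
case=> fr fi; rewrite /cpartial /partial (@derive_val _ _ _ _ _ _ _ fr).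
by rewrite (@derive_val _ _ _ _ _ _ _ fi); case: (z).
Qed.

Lemma has_cpartial_cst c : has_cpartial (fun=> c) 0.
Proof. by split; exact: is_derive_cst. Qed.

Lemma has_cpartialD f g a b : has_cpartial f a -> has_cpartial g b ->
  has_cpartial (fun y => f y + g y) (a + b).
Proof.
move=> [f1 f2] [g1 g2]; split.
  apply: (is_derive_ext (is_derive_add f1 g1)); last by case: (a); case: (b).
  by move=> y; case: (f y); case: (g y).
apply: (is_derive_ext (is_derive_add f2 g2)); last by case: (a); case: (b).
by move=> y; case: (f y); case: (g y).
Qed.

Lemma has_cpartialM f g a b : has_cpartial f a -> has_cpartial g b ->
  has_cpartial (fun y => f y * g y) (a * g x + f x * b).
Proof.
move=> [f1 f2] [g1 g2]; split.
  apply: (is_derive_ext (is_derive_add (is_derive_mul f1 g1)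
    (is_derive_opp (is_derive_mul f2 g2)))).
    by move=> y; case: (f y); case: (g y).
  by case: (a); case: (b); case: (f x); case: (g x) => * /=; ring.
apply: (is_derive_ext (is_derive_add (is_derive_mul f1 g2) (is_derive_mul f2 g1))).
  by move=> y; case: (f y); case: (g y).
by case: (a); case: (b); case: (f x); case: (g x) => * /=; ring.
Qed.

Lemma cderivable_cst c : cderivable (fun=> c).
Proof. exact: has_cpartial_derivable (has_cpartial_cst c). Qed.

Lemma cpartial_cst c : cpartial k (fun=> c) x = 0.
Proof. exact: has_cpartialE (has_cpartial_cst c). Qed.

Lemma cderivableD f g : cderivable f -> cderivable g -> cderivable (fun y => f y + g y).
Proof.
by move=> /cderivableP fd /cderivableP gd; exact: has_cpartial_derivable (has_cpartialD fd gd).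
Qed.

Lemma cpartialD f g : cderivable f -> cderivable g ->
  cpartial k (fun y => f y + g y) x = cpartial k f x + cpartial k g x.
Proof.
by move=> /cderivableP fd /cderivableP gd; exact: has_cpartialE (has_cpartialD fd gd).
Qed.

Lemma cderivableM f g : cderivable f -> cderivable g -> cderivable (fun y => f y * g y).
Proof.
by move=> /cderivableP fd /cderivableP gd; exact: has_cpartial_derivable (has_cpartialM fd gd).
Qed.

Lemma cpartialM f g : cderivable f -> cderivable g ->
  cpartial k (fun y => f y * g y) x = cpartial k f x * g x + f x * cpartial k g x.
Proof.
by move=> /cderivableP fd /cderivableP gd; exact: has_cpartialE (has_cpartialM fd gd).
Qed.

Lemma cderivable_sum (I : Type) (r : seq I) (f : I -> 'rV[R]_n -> C) :
  (forall i, cderivable (f i)) -> cderivable (fun y => \sum_(i <- r) f i y).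
Proof.
move=> fd; elim: r => [|i r IH].
  have -> : (fun y => \sum_(i <- [::]) f i y) = (fun=> 0) by apply/funext => y; rewrite big_nil.
  exact: cderivable_cst.
have -> : (fun y => \sum_(i0 <- i :: r) f i0 y) = (fun y => f i y + \sum_(j <- r) f j y).
  by apply/funext => y; rewrite big_cons.
exact: (cderivableD (fd i) IH).
Qed.

Lemma cpartial_sum (I : Type) (r : seq I) (f : I -> 'rV[R]_n -> C) :
  (forall i, cderivable (f i)) ->
  cpartial k (fun y => \sum_(i <- r) f i y) x = \sum_(i <- r) cpartial k (f i) x.
Proof.
move=> fd; elim: r => [|i r IH].
  have -> : (fun y => \sum_(i <- [::]) f i y) = (fun=> 0) by apply/funext => y; rewrite big_nil.
  by rewrite cpartial_cst big_nil.
have -> : (fun y => \sum_(i0 <- i :: r) f i0 y) = (fun y => f i y + \sum_(j <- r) f j y).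
  by apply/funext => y; rewrite big_cons.
by rewrite cpartialD ?IH ?big_cons //; exact: cderivable_sum.
Qed.

Definition mxderivable p q (a : 'rV[R]_n -> 'M[C]_(p, q)) : Prop :=
  forall i j, cderivable (fun y => a y i j).

Definition mxpartial p q (a : 'rV[R]_n -> 'M[C]_(p, q)) : 'M[C]_(p, q) :=
  \matrix_(i, j) cpartial k (fun y => a y i j) x.

Lemma mxderivable_cst p q (a : 'M[C]_(p, q)) : mxderivable (fun=> a).
Proof. by move=> i j; exact: cderivable_cst. Qed.

Lemma mxpartial_cst p q (a : 'M[C]_(p, q)) : mxpartial (fun=> a) = 0.
Proof. by apply/matrixP => i j; rewrite !mxE cpartial_cst. Qed.

Lemma mxderivableM p q r (a : 'rV[R]_n -> 'M[C]_(p, q)) (b : 'rV[R]_n -> 'M[C]_(q, r)) :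
  mxderivable a -> mxderivable b -> mxderivable (fun y => a y *m b y).
Proof.
move=> ad bd i j.
have -> : (fun y => (a y *m b y) i j) = (fun y => \sum_l a y i l * b y l j).
  by apply/funext => y; rewrite mxE.
by apply: cderivable_sum => l; exact: cderivableM.
Qed.

Lemma mxpartialM p q r (a : 'rV[R]_n -> 'M[C]_(p, q)) (b : 'rV[R]_n -> 'M[C]_(q, r)) :
  mxderivable a -> mxderivable b ->
  mxpartial (fun y => a y *m b y) = mxpartial a *m b x + a x *m mxpartial b.
Proof.
move=> ad bd; apply/matrixP => i j; rewrite !mxE -big_split /=.
have -> : (fun y => (a y *m b y) i j) = (fun y => \sum_l a y i l * b y l j).
  by apply/funext => y; rewrite mxE.
rewrite cpartial_sum => [|l]; last exact: cderivableM.
by apply: eq_bigr => l _; rewrite cpartialM // !mxE.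
Qed.

Lemma mxderivable_tens p q r s (a : 'rV[R]_n -> 'M[C]_(p, q)) (b : 'rV[R]_n -> 'M[C]_(r, s)) :
  mxderivable a -> mxderivable b -> mxderivable (fun y => a y *t b y).
Proof.
move=> ad bd i j; case: (mxtens_indexP i) => i0 i1; case: (mxtens_indexP j) => j0 j1.
under eq_fun => y do rewrite tensmxE.
exact: cderivableM.
Qed.

Lemma mxpartial_tens p q r s (a : 'rV[R]_n -> 'M[C]_(p, q)) (b : 'rV[R]_n -> 'M[C]_(r, s)) :
  mxderivable a -> mxderivable b ->
  mxpartial (fun y => a y *t b y) = mxpartial a *t b x + a x *t mxpartial b.
Proof.
move=> ad bd; apply/matrixP => i j.
case: (mxtens_indexP i) => i0 i1; case: (mxtens_indexP j) => j0 j1.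
rewrite mxE [RHS]mxE !tensmxE; under eq_fun => y do rewrite tensmxE.
by rewrite cpartialM // !mxE.
Qed.

End ComplexPartial.

(** * Maurer-Cartan forms of bundle automorphisms *)

Section ExtDerivable.
Variables (R : realType) (n : nat) (k : 'I_n) (x : 'rV[R]_n).

(** Along the first column index, [ext_mx_intertwine] writes the entries in degree
   p + 1 as polynomials in those of h and of the exterior power of degree p. *)
Lemma mxderivable_ext N p (h : 'rV[R]_n -> 'M[R[i]]_N) :
  mxderivable k x h -> mxderivable k x (fun y => ext_mx p (h y)).
Proof.
move=> hd; elim: p => [|p IH].
  have -> : (fun y => ext_mx 0 (h y)) = (fun=> 1%:M) by apply/funext => y; rewrite ext_mx0.
  exact: mxderivable_cst.
move=> I J; have [L LE] := creation_head (R[i] : comNzRingType) J.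
have -> : (fun y => ext_mx p.+1 (h y) I J) =
    (fun y => \sum_c h y c (mindex J ord0) * (creation R[i] p c *m ext_mx p (h y)) I L).
  apply/funext => y; rewrite -(mul_creation_head _ LE) ext_mx_intertwine summxE.
  by apply: eq_bigr => c _; rewrite mxE.
apply: cderivable_sum => c; apply: cderivableM => //.
by apply: mxderivableM => //; exact: mxderivable_cst.
Qed.

End ExtDerivable.

Lemma invmx_intertwine (K : comUnitRingType) r s (A dA : 'M[K]_r) (B dB : 'M[K]_s)
    (P : 'M[K]_(r, s)) :
  A \in unitmx -> B \in unitmx -> A *m P = P *m B -> dA *m P = P *m dB ->
  invmx A *m dA *m P = P *m (invmx B *m dB).
Proof.
move=> Au Bu AP dP; rewrite -mulmxA dP !mulmxA; congr (_ *m _).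
by rewrite -[LHS](mulmxK Bu) -[_ *m P *m B]mulmxA -AP mulmxA mulVmx // mul1mx.
Qed.

Section MaurerCartan.
Variables (R : realType) (M : topologicalType) (n : nat) (X : manifold R n M).
Variables (i : ix X) (x : 'rV[R]_n).
Local Notation C := R[i].
Implicit Types (V W : abundle R M) (k : 'I_n).

Definition local_form W (y : 'rV[R]_n) : 'M[C]_(arank W) := automorphism W (param i y).

Definition regular_at W : Prop :=
  local_form W x \in unitmx /\ forall k, mxderivable k x (local_form W).

(** The matrix of the dx_k component of the Maurer-Cartan form. *)
Definition mc W k : 'M[C]_(arank W) :=
  invmx (local_form W x) *m mxpartial k x (local_form W).

Lemma maurer_cartanE W : maurer_cartan i x W = one_form_mx (mc W).
Proof.
rewrite /maurer_cartan.
have -> : mx_differential (fun y => automorphism W (param i y)) x =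
    one_form_mx (fun k => mxpartial k x (local_form W)).
  by apply/matrixP => p q; rewrite !mxE; apply: eq_bigr => k _; rewrite mxE.
rewrite !one_form_mx_sum mulmx_sumr; apply: eq_bigr => k _.
by rewrite -(val_even_cst_mx n (invmx _)) even_mx_scale val_even_cst_mx -cst_mxM.
Qed.

Lemma local_mc W k : regular_at W -> local_form W x *m mc W k = mxpartial k x (local_form W).
Proof. by case=> Wu _; rewrite /mc mulmxA mulmxV // mul1mx. Qed.

Lemma mc_eq W k Z : regular_at W ->
  local_form W x *m Z = mxpartial k x (local_form W) -> mc W k = Z.
Proof. by case=> Wu _ e; rewrite /mc -e mulmxA mulVmx // mul1mx. Qed.

(** Differentiate V P = P W with P constant. *)
Lemma mc_intertwine V W (P : 'M[C]_(arank V, arank W)) k :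
  regular_at V -> regular_at W ->
  (forall y, local_form V y *m P = P *m local_form W y) ->
  mc V k *m P = P *m mc W k.
Proof.
move=> Vr Wr VP; have [Vu Vd] := Vr; have [Wu Wd] := Wr.
have dP : mxpartial k x (local_form V) *m P = P *m mxpartial k x (local_form W).
  have := mxpartialM (Vd k) (mxderivable_cst k x P).
  rewrite mxpartial_cst mulmx0 addr0 => <-.
  rewrite (_ : (fun y => local_form V y *m P) = (fun y => P *m local_form W y)); last first.
    by apply/funext => y.
  by rewrite (mxpartialM (mxderivable_cst k x P) (Wd k)) mxpartial_cst mul0mx add0r.
exact: invmx_intertwine.
Qed.

Lemma regular_trivial m : regular_at (atrivial R M m).
Proof.
split=> [|k]; first by rewrite /local_form /= unitmx1.
exact: (mxderivable_cst k x (1%:M : 'M[C]_m)).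
Qed.

Lemma mc_trivial m k : mc (atrivial R M m) k = 0.
Proof. by rewrite /mc (mxpartial_cst k x (1%:M : 'M[C]_m)) mulmx0. Qed.

Lemma local_tensor V W y :
  local_form (atensor V W) y = local_form V y *t local_form W y.
Proof. by []. Qed.

Lemma local_ext p V y : local_form (aext p V) y = ext_mx p (local_form V y).
Proof. by []. Qed.

Lemma regular_tensor V W : regular_at V -> regular_at W -> regular_at (atensor V W).
Proof.
move=> [Vu Vd] [Wu Wd]; split=> [|k]; last exact: mxderivable_tens.
have : (local_form V x *t local_form W x) *m
    (invmx (local_form V x) *t invmx (local_form W x)) = 1%:M.
  by rewrite tensmx_mul !mulmxV // tensmx11.
by rewrite local_tensor => /mulmx1_unit[u _]; exact: u.
Qed.

Lemma mc_tensor V W k : regular_at V -> regular_at W ->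
  mc (atensor V W) k = mc V k *t 1%:M + 1%:M *t mc W k.
Proof.
move=> Vr Wr; apply: mc_eq; first exact: regular_tensor.
have [_ Vd] := Vr; have [_ Wd] := Wr.
rewrite [RHS](mxpartial_tens (Vd k) (Wd k)) mulmxDr /local_form /= !tensmx_mul !mulmx1.
by rewrite -![automorphism _ _]/(local_form _ _) !local_mc.
Qed.

Lemma regular_ext p V : regular_at V -> regular_at (aext p V).
Proof.
move=> [Vu Vd]; split=> [|k]; last exact: mxderivable_ext.
have : ext_mx p (local_form V x) *m ext_mx p (invmx (local_form V x)) = 1%:M.
  by rewrite -ext_mxM mulmxV // ext_mx1.
by rewrite local_ext => /mulmx1_unit[u _]; exact: u.
Qed.

(** Exterior multiplication intertwines the tensor product of V with its exterior power
   of degree p and the exterior power of degree p + 1; [mc_intertwine] turns this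
   into the recursion that characterizes [ext_der]. *)
Lemma mc_ext p V k : regular_at V -> mc (aext p V) k = ext_der p (mc V k).
Proof.
move=> Vr; apply: (@ext_der_unique _ _ (mc V k) (fun p => mc (aext p V) k)) => [|{}p].
  rewrite /mc (_ : local_form _ = fun=> 1%:M) ?mxpartial_cst ?mulmx0 //.
  by apply/funext => y; rewrite /local_form /= ext_mx0.
have Er := regular_ext p Vr; rewrite -[X in _ = _ *m X](mc_tensor k Vr Er).
apply: (@mc_intertwine (aext p.+1 V) (atensor V (aext p V))) => [||y].
- exact: regular_ext.
- exact: regular_tensor.
by rewrite !local_ext local_tensor; exact: ext_mx_row_blocks.
Qed.

Definition mc_trace m W : ext_form C n := \tr (maurer_cartan i x W ^+ m.*2.+1).

Lemma mc_trace_trivial p m : mc_trace m (atrivial R M p) = 0.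
Proof.
rewrite /mc_trace maurer_cartanE mxtrace_odd_power big1 // => k _.
by rewrite mc_trivial map_mx0 mulmx0 raddf0 rmorph0 mulr0.
Qed.

Lemma mc_trace_tensor m V W : regular_at V -> regular_at W ->
  mc_trace m (atensor V W) = mc_trace m V *+ arank W + mc_trace m W *+ arank V.
Proof.
move=> Vr Wr; rewrite /mc_trace (maurer_cartanE V) (maurer_cartanE W).
have -> : maurer_cartan i x (atensor V W) =
    one_form_mx (fun k => mc V k *t 1%:M + 1%:M *t mc W k).
  by rewrite maurer_cartanE; apply: eq_one_form_mx => k; rewrite mc_tensor.
exact: mxtrace_odd_tens.
Qed.

Lemma mc_trace_ext p m V : regular_at V ->
  mc_trace m (aext p V) = (ext_coef (arank V) p m)%:~R *: mc_trace m V.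
Proof.
move=> Vr; rewrite /mc_trace (maurer_cartanE V).
have -> : maurer_cartan i x (aext p V) = one_form_mx (fun k => ext_der p (mc V k)).
  by rewrite maurer_cartanE; apply: eq_one_form_mx => k; rewrite mc_ext.
exact: mxtrace_odd_ext.
Qed.

Definition odd_coef (k : nat) : C :=
  (k`!)%:R / ((k.*2.+1)`!)%:R * (2 * (pi : R)%:C%C * ('i)%C) ^- k.+1.

Lemma ch_odd_bundleE W :
  ch_odd_bundle i x W = \sum_(1 <= k < n.+1) odd_coef k *: mc_trace k W.
Proof. by []. Qed.

End MaurerCartan.

(** * Orthogonal automorphisms and their spin lifts *)

Section Antisymmetric.
Variables (F : numFieldType) (n N : nat) (a : 'I_n -> 'M[F]_N).
Hypothesis a_antisym : forall j, (a j)^T = - a j.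
Local Notation K := (even_form F n).

Lemma square_mx_antisym : (square_mx a)^T = - square_mx a.
Proof.
rewrite raddf_sum [in RHS]/square_mx exchange_big -sumrN; apply: eq_bigr => k _ /=.
rewrite raddf_sum -sumrN; apply: eq_bigr => l _ /=.
by rewrite linearZ /= map_trmx trmx_mul !a_antisym mulmxN mulNmx opprK dx2C scaleNr.
Qed.

(** Transposition reverses T^2 a_j and changes the sign of each of the three factors
   T, T, a_j. *)
Lemma mxtrace_odd5_antisym : \tr (one_form_mx a ^+ 5) = 0.
Proof.
rewrite -[5%N]/(2.*2.+1) mxtrace_odd_power big1 // => j _.
suff -> : \tr (square_mx a ^+ 2 *m map_mx (@even_cst F n) (a j)) = 0.
  by rewrite rmorph0 mulr0.
apply: even_double_eq0; rewrite -{1}mxtrace_tr trmx_mul map_trmx a_antisym.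
rewrite expr2 -[_ * _]/(_ *m _) trmx_mul square_mx_antisym mulNmx !mulmxN opprK.
by rewrite map_mxN mulNmx raddfN /= [X in - X + _]mxtrace_mulC addNr.
Qed.

End Antisymmetric.

Section CliffordUnits.
Variables (R : rcfType) (N : nat).
Hypothesis N_even : ~~ odd N.
Local Notation C := R[i].
Local Notation gm := (@clifford_gen R N).

Lemma cliffordE (u : 'rV[R]_N) : clifford u = \sum_j (u 0 j)%:C%C *: gm j.
Proof. by []. Qed.

(** The off-diagonal terms cancel in pairs by anticommutation. *)
Lemma clifford_square (u : 'rV[R]_N) : u *m u^T = 1%:M ->
  clifford u *m clifford u = - 1%:M.
Proof.
move=> u1; have dbl : clifford u *m clifford u + clifford u *m clifford u = (- 1%:M) *+ 2.
  transitivity (\sum_c \sum_l ((u 0 c)%:C%C * (u 0 l)%:C%C) *: (gm l *m gm c + gm c *m gm l)).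
    under eq_bigr do (under eq_bigr do rewrite scalerDr; rewrite big_split /=).
    rewrite big_split /=; congr (_ + _); rewrite !cliffordE mulmx_suml; last first.
      apply: eq_bigr => c _; rewrite mulmx_sumr; apply: eq_bigr => l _.
      by rewrite -scalemxAl -scalemxAr scalerA.
    rewrite exchange_big; apply: eq_bigr => c _; rewrite mulmx_sumr; apply: eq_bigr => l _ /=.
    by rewrite -scalemxAl -scalemxAr scalerA mulrC.
  have -> : (- 1%:M) *+ 2 =
      \sum_c real_complex R (u 0 c ^+ 2) *: ((- 2)%:M : 'M[C]_(spin_rank N)).
    rewrite -scaler_suml -rmorph_sum.
    have -> : \sum_c u 0 c ^+ 2 = 1.
      have := congr1 (fun A : 'M[R]_1 => A 0 0) u1; rewrite !mxE eqxx mulr1n => <-.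
      by apply: eq_bigr => c _; rewrite mxE expr2.
    by rewrite rmorph1 scale1r -raddfN -raddfMn /= mulNrn.
  apply: eq_bigr => c _; rewrite (bigD1 c) //= [X in _ + X]big1 ?addr0 => [|l /negbTE lc].
    by rewrite [X in _ *: (X + _)]clifford_gen_anticommute // eqxx mulr1n addrNK -rmorphM expr2.
  by rewrite [X in _ *: (X + _)]clifford_gen_anticommute // eq_sym lc mulr0n raddf0 addrNK scaler0.
apply/eqP; rewrite -subr_eq0 opprK; apply/eqP.
have : (2 : C) *: (clifford u *m clifford u + 1%:M) = 0.
  by rewrite scaler_nat mulrnDl mulr2n dbl mulNrn addNr.
by move/eqP; rewrite scaler_eq0 pnatr_eq0 => /eqP.
Qed.

Lemma spin_unit (s : 'M[C]_(spin_rank N)) : spin s -> s \in unitmx.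
Proof.
case=> us [_ /allP us1 ->]; elim: us us1 => [|u us IH] us1.
  by rewrite big_nil unitmx1.
rewrite big_cons -[_ * _]/(_ *m _) unitmx_mul; apply/andP; split.
  have /eqP/clifford_square cu := us1 u (mem_head _ _).
  have : clifford u *m (- clifford u) = 1%:M by rewrite mulmxN cu opprK.
  by case/mulmx1_unit => uu _; exact: uu.
by apply: IH => w wus; apply: us1; rewrite inE wus orbT.
Qed.

(** The relation s v s^-1 = A v says that Clifford multiplication, from the tensor
   product of the vector and the spinor module to the spinor module, is equivariant. *)
Lemma spin_over_intertwine (s : 'M[C]_(spin_rank N)) (A : 'M[R]_N) :
  spin_over s A ->
  s *m row_blocks gm = row_blocks gm *m (map_mx (real_complex R) A *t s).
Proof.
case=> _ sA; rewrite mul_row_blocks row_blocks_tens; apply: eq_row_blocks => j.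
have deltaE : clifford (delta_mx 0 j) = gm j.
  rewrite cliffordE (bigD1 j) //= [X in _ + X]big1 ?addr0 => [|l /negbTE lj].
    by rewrite mxE !eqxx scale1r.
  by rewrite mxE lj andbF scale0r.
rewrite -deltaE sA cliffordE mulmx_suml; apply: eq_bigr => c _.
rewrite -scalemxAl; congr (_ *: _); rewrite [RHS]mxE; congr (real_complex R _).
rewrite mxE (bigD1 j) //= big1 => [|l /negbTE lj]; first by rewrite !mxE !eqxx mul1r addr0.
by rewrite !mxE lj andbF mul0r.
Qed.

End CliffordUnits.

Section OrthogonalAndSpin.
Variables (R : realType) (M : topologicalType) (n : nat) (X : manifold R n M).
Variables (i : ix X) (x : 'rV[R]_n) (x_in : chart_image i x).
Variables (N : nat) (N_even : ~~ odd N) (g : M -> 'M[R]_N).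
Variables (g_smooth : smooth_map X g) (g_SO : forall p, special_orthogonal (g p)).
Variables (gs : M -> 'M[R[i]]_(spin_rank N)).
Variables (gs_smooth : csmooth_map X gs) (gs_lift : forall p, spin_over (gs p) (g p)).
Local Notation C := R[i].
Local Notation E := (complexified g).
Local Notation DE := {| arank := spin_rank N; automorphism := gs |}.

Lemma smooth_derivable (U : set 'rV[R]_n) (f : 'rV[R]_n -> R) k :
  smooth_on U f -> U x -> derivable f x (delta_mx 0 k).
Proof. by move=> /(_ 1%N)[_ /(_ k)[fd _]] Ux; exact: fd. Qed.

Lemma orthogonal_complex (p : M) :
  (automorphism E p)^T *m automorphism E p = 1%:M.
Proof.
have [/mulmx1C go _] := g_SO p.
by rewrite /= map_trmx -map_mxM go map_mx1.
Qed.

Lemma regular_orthogonal : regular_at i x E.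
Proof.
split=> [|k a b].
  by have /mulmx1_unit[_ u] := orthogonal_complex (param i x); exact: u.
split.
  rewrite (_ : (fun y => _) = (fun y => g (param i y) a b)).
    exact: smooth_derivable (g_smooth i a b) x_in.
  by apply/funext => y; rewrite /local_form /= mxE.
rewrite (_ : (fun y => _) = (fun=> 0)); first exact: derivable_cst.
by apply/funext => y; rewrite /local_form /= mxE.
Qed.

Lemma regular_spin : regular_at i x DE.
Proof.
split=> [|k a b].
  by have [su _] := gs_lift (param i x); exact: spin_unit su.
have [sr si] := gs_smooth i a b.
by split; [exact: smooth_derivable sr x_in | exact: smooth_derivable si x_in].
Qed.

Lemma mc_antisym k : (mc i x E k)^T = - mc i x E k.
Proof.
have [_ Ed] := regular_orthogonal; have AA := orthogonal_complex.
pose A y := local_form i E y; pose dA := mxpartial k x A.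
have AT : invmx (A x) = (A x)^T.
  have [Au _] := regular_orthogonal.
  by rewrite -[LHS]mul1mx -(AA (param i x)) mulmxK.
have dAT : mxpartial k x (fun y => (A y)^T) = dA^T.
  by apply/matrixP => a b; rewrite !mxE; under eq_fun do rewrite mxE.
have AdT : mxderivable k x (fun y => (A y)^T).
  by move=> a b; under eq_fun do rewrite mxE; exact: Ed.
have := mxpartialM AdT (Ed k).
rewrite (_ : (fun y => _) = (fun=> 1%:M)); last by apply/funext => y; exact: AA.
rewrite mxpartial_cst dAT => /esym/eqP; rewrite addr_eq0 => /eqP dAA.
by rewrite /mc AT trmx_mul trmxK dAA.
Qed.

Lemma mc_spin k : mc i x DE k *m row_blocks (@clifford_gen R N) =
  row_blocks (@clifford_gen R N) *m (mc i x E k *t 1%:M + 1%:M *t mc i x DE k).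
Proof.
have Er := regular_orthogonal; have Dr := regular_spin.
rewrite -(mc_tensor k Er Dr).
apply: (@mc_intertwine _ _ _ _ i x DE (atensor E DE)) => [||y].
- exact: Dr.
- exact: regular_tensor Er Dr.
exact: spin_over_intertwine (gs_lift (param i y)).
Qed.

Lemma mc_trace_orthogonal2 : mc_trace i x 2 E = 0.
Proof. by rewrite /mc_trace maurer_cartanE; apply: mxtrace_odd5_antisym; exact: mc_antisym. Qed.

Lemma mc_trace_spin1 : mc_trace i x 1 DE *+ 8 = mc_trace i x 1 E *+ spin_rank N.
Proof.
rewrite /mc_trace !maurer_cartanE.
have H := mxtrace_odd_spin3 (@clifford_gen_anticommute R N N_even)
  (@clifford_gen_schur R N N_even) mc_antisym mc_spin.
exact: H.
Qed.

Lemma mc_trace_spin2 : mc_trace i x 2 DE = 0.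
Proof.
rewrite /mc_trace maurer_cartanE.
have H := mxtrace_odd_spin5 (@clifford_gen_anticommute R N N_even)
  (@clifford_gen_schur R N N_even) mc_antisym mc_spin.
exact: H.
Qed.

Lemma mc_trace_spin3 : mc_trace i x 3 DE *+ 16 = - (mc_trace i x 3 E *+ spin_rank N).
Proof.
rewrite /mc_trace !maurer_cartanE.
have H := mxtrace_odd_spin7 (@clifford_gen_anticommute R N N_even)
  (@clifford_gen_schur R N N_even) mc_antisym mc_spin.
exact: H.
Qed.

End OrthogonalAndSpin.

(** * Degree 0: the rank *)

Section Augmentation.
Variables (F : numFieldType) (n : nat).
Local Notation form := (ext_form F n).
Local Notation augm := (map_mx (@aug F n)).

Lemma map_aug_exp r (A : 'M[form]_r) k : augm (A ^+ k) = augm A ^+ k.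
Proof.
elim: k => [|k IH]; first by rewrite !expr0 map_mx1.
by rewrite !exprS -IH [LHS]map_mxM.
Qed.

Lemma map_aug_powers r (A : 'M[form]_r) (c : nat -> form) m :
  augm A = 0 -> augm (\sum_(k < m.+1) c k *: A ^+ k) = (aug (c 0%N))%:M.
Proof.
move=> A0; rewrite raddf_sum big_ord_recl big1 /= => [|k _].
  by rewrite expr0 map_mxZ map_mx1 addr0 scalemx1.
rewrite map_mxZ map_aug_exp A0 /bump add1n exprS.
by rewrite -[0 * _]/(0 *m _) mul0mx scaler0.
Qed.

Lemma aug_scalar (c : F) : aug (c%:A : form) = c.
Proof. by rewrite augZ rmorph1 mulr1. Qed.

End Augmentation.

Section DegreeZero.
Variables (R : realType) (n : nat) (M : topologicalType) (X : manifold R n M).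
Variables (i : ix X) (x : 'rV[R]_n).
Local Notation C := R[i].
Local Notation form := (ext_form C n).
Local Notation augm := (map_mx (@aug C n)).

(** Holds for matrices of 1-forms, and is preserved by the tensor operations because
   [aug] is a ring morphism. *)
Definition connection0 (V : cbundle X) : Prop := augm (connection V i x) = 0.

Lemma aug_curvature V : connection0 V -> augm (curvature V i x) = 0.
Proof.
move=> V0; rewrite /curvature map_mxD map_mxM V0 mul0mx addr0.
apply/matrixP => p q; rewrite !mxE raddf_sum big1 // => k _.
by rewrite /= rmorphM /= aug_dx mul0r.
Qed.

(** The curvature has no component of degree 0, so only the term k = 0 contributes. *)
Lemma aug_ch_bundle V : connection0 V -> aug (ch_bundle i x V) = (crank V)%:R.
Proof.
move=> /aug_curvature V0; rewrite /ch_bundle -trace_map_mx.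
rewrite (@map_aug_powers _ _ _ _ (fun k => (('i / (2 * pi%:C)) ^+ k / (k`!)%:R)%:A)%C) //.
by rewrite aug_scalar expr0 fact0 divr1 mxtrace1.
Qed.

Lemma connection0_trivial m : connection0 (ctrivial X m).
Proof. exact: map_mx0. Qed.

Lemma connection0_tensor V W : connection0 V -> connection0 W -> connection0 (ctensor V W).
Proof.
move=> V0 W0; rewrite /connection0 /= map_mxD !map_mxT V0 W0.
by rewrite tens0mx tensmx0 addr0.
Qed.

Lemma connection0_ext p V : connection0 V -> connection0 (cext p V).
Proof.
move=> V0; apply/matrixP => I J; rewrite !mxE rmorph_sum big1 // => q _.
rewrite -det_map_mx (expand_det_row _ q) big1 // => q' _.
rewrite !mxE eqxx; have := congr1 (fun A : 'M[C]_(crank V) => A (mindex I q) (mindex J q')) V0.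
by rewrite !mxE /= => ->; rewrite mul0r.
Qed.

Variables (G : metric X) (S : spin_structure G).

Lemma aug_levi_civita : augm (levi_civita S i x) = 0.
Proof.
apply/matrixP => p q; rewrite !mxE raddf_sum big1 // => k _.
by rewrite /= augZ aug_dx mulr0.
Qed.

Lemma connection0_tangent : connection0 (complex_tangent S).
Proof. exact: aug_levi_civita. Qed.

Lemma connection0_spinor : connection0 (spinor_bundle S).
Proof.
rewrite /connection0 /= /spin_rep raddf_sum big1 // => a _.
rewrite raddf_sum big1 // => b _; rewrite /= map_mxZ rmorphM /=.
have -> : aug (levi_civita S i x b a) = 0.
  by have := congr1 (fun A : 'M[C]_n => A b a) aug_levi_civita; rewrite !mxE.
by rewrite mulr0 scale0r.
Qed.

End DegreeZero.

Section VirtualRank.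
Variables (R : realType) (n : nat) (M : topologicalType) (X : manifold R n M).
Variables (i : ix X) (x : 'rV[R]_n).
Local Notation ops := (cbundle_ops X).
Local Notation good := (all_bundles (T := ops) (connection0 (X := X) i x)).

Definition rank_ch (V : cbundle X) : R[i] := aug (ch_bundle i x V).

Local Notation phi := (additive_ext (T := ops) rank_ch).

Lemma aug_ch (V : virtual ops) : aug (ch i x V) = phi V.
Proof.
rewrite /ch /additive_ext rmorph_sum; apply: eq_bigr => v _.
by rewrite rmorphM rmorph_sign.
Qed.

Lemma rank_chE (V : cbundle X) : connection0 i x V -> rank_ch V = (crank V)%:R.
Proof. exact: aug_ch_bundle. Qed.

Lemma rank_ch_tensor V W : connection0 i x V -> connection0 i x W ->
  rank_ch (ctensor V W) = rank_ch V * rank_ch W.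
Proof.
move=> V0 W0; have VW0 := connection0_tensor V0 W0.
by rewrite !rank_chE // [crank (ctensor V W)]/= natrM.
Qed.

Lemma rank_ch_ext k V : connection0 i x V ->
  rank_ch (cext k V) = ('C(crank V, k))%:R.
Proof.
move=> V0; rewrite rank_chE; last exact: connection0_ext.
by rewrite [crank (cext k V)]card_increasing.
Qed.

Lemma rank_ch_trivial m : rank_ch (ctrivial X m) = m%:R.
Proof. by rewrite rank_chE //; exact: connection0_trivial. Qed.

Let triv := connection0_trivial (X := X) i x.
Let tens := connection0_tensor (X := X) (i := i) (x := x).
Let exts k V (V0 : connection0 i x V) := connection0_ext (X := X) k V0.

Let unit1 : rank_ch (trivial ops 1) = 1.
Proof. exact: rank_ch_trivial. Qed.

Section Reduced.
Variables (V : cbundle X) (V0 : connection0 i x V).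
Local Notation T := (reduced (T := ops) V).

Let good_T : good T := all_bundles_reduced (T := ops) triv V0.

Lemma rank_reduced : phi T = 0.
Proof.
by rewrite additive_ext_reduced [rank_ch (trivial _ _)]rank_ch_trivial [f in f - _]rank_chE ?subrr.
Qed.

(** Lambda_t(V - C^r) has rank series (1 + t)^r / (1 + t)^r = 1. *)
Lemma rank_vwedge k : phi (vwedge k T) = (k == 0)%:R.
Proof.
rewrite (additive_ext_vwedge_reduced (T := ops) triv tens exts rank_ch_tensor unit1 k
  (m := fun k => (k == 0)%:R) V0) // => j.
  by rewrite [LHS]rank_ch_ext //; exact: triv.
by rewrite convolve1l; exact: rank_ch_ext.
Qed.

Lemma rank_vsym k : phi (vsym k T) = (k == 0)%:R.
Proof.
exact: (additive_ext_vsym (T := ops) triv tens exts rank_ch_tensor unit1 k good_T rank_vwedge).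
Qed.

Lemma good_vwedge k : good (vwedge k T).
Proof. exact: (all_bundles_vwedge (T := ops) triv tens exts). Qed.

Lemma good_vsym k : good (vsym k T).
Proof. exact: (all_bundles_vsym (T := ops) triv tens exts). Qed.

End Reduced.

End VirtualRank.

(** * Degree 7: the odd Chern character *)

Section HomogTrace.
Variables (F : numFieldType) (n : nat).
Local Notation form := (ext_form F n).

Lemma homog_one_form_mx r (a : 'I_n -> 'M[F]_r) p q : homog 1 (one_form_mx a p q).
Proof.
by rewrite mxE; apply: homog_sum => k _; apply: homogZ; exact: homog_dx.
Qed.

Lemma homog_mx_exp r (A : 'M[form]_r) m :
  (forall p q, homog 1 (A p q)) -> forall p q, homog m ((A ^+ m) p q).
Proof.
move=> hA; elim: m => [|m IH] p q.
  rewrite expr0 mxE; case: eqP => _; [exact: homog1 | exact: homog0].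
rewrite exprS -[_ * _]/(_ *m _) mxE; apply: homog_sum => j _.
exact: (homogM (hA p j) (IH j q)).
Qed.

Lemma homog_mxtrace r (a : 'I_n -> 'M[F]_r) m : homog m (\tr (one_form_mx a ^+ m)).
Proof.
by apply: homog_sum => p _; apply: homog_mx_exp; exact: homog_one_form_mx.
Qed.

Lemma sum_degree7 (V : lmodType F) (c : nat -> F) (t : nat -> V) :
  t 1 = 0 -> t 2 = 0 -> (forall k, (4 <= k)%N -> t k = 0) ->
  \sum_(1 <= k < 8) c k *: t k = c 3 *: t 3.
Proof.
move=> t1 t2 t4; do 3 rewrite big_ltn //.
rewrite t1 t2 !scaler0 !add0r big_nat_cond big1 ?addr0 // => k; rewrite andbT => /andP[k4 _].
by rewrite t4 ?scaler0.
Qed.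

End HomogTrace.

Lemma twist_multiple (V : zmodType) (c D : V) d q m :
  D *+ q = - (c *+ d) -> - (c *+ d *+ m) = D *+ (q * m).
Proof. by move=> h; rewrite mulrnA h mulNrn. Qed.

Lemma scale_mulrn2 (K : pzRingType) (V : lmodType K) (c : K) (s t : V) p q :
  c *: (s *+ p + t *+ q) = (c *: t) *+ q + (c *: s) *+ p.
Proof. by rewrite scalerDr !scalerMnr addrC. Qed.

Section Degree7.
Variables (R : realType) (M : topologicalType) (X : manifold R 7 M).
Variables (i : ix X) (x : 'rV[R]_7).
Local Notation C := R[i].
Local Notation form := (ext_form C 7).
Local Notation ch1 := (ch_odd_bundle i x).

(** The odd Chern character form of W then consists of its degree 7 term. *)
Definition top_odd (W : abundle R M) : Prop :=
  [/\ regular_at i x W, mc_trace i x 1 W = 0 & mc_trace i x 2 W = 0].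

Lemma ch_odd_bundle_top W : top_odd W -> ch1 W = odd_coef R 3 *: mc_trace i x 3 W.
Proof.
case=> _ t1 t2; rewrite ch_odd_bundleE.
have t4 k : (4 <= k)%N -> mc_trace i x k W = 0.
  move=> k4; apply: (@homog_large _ _ k.*2.+1); last by lia.
  by rewrite /mc_trace maurer_cartanE; exact: homog_mxtrace.
exact: (sum_degree7 (odd_coef R) t1 t2 t4).
Qed.

Lemma homog_ch_odd W : top_odd W -> homog 7 (ch1 W).
Proof.
move=> /ch_odd_bundle_top ->; apply: homogZ.
by rewrite /mc_trace maurer_cartanE; exact: (@homog_mxtrace _ _ _ _ 7).
Qed.

Lemma mul_top_top (a b : form) : homog 7 a -> homog 7 b -> a * b = 0.
Proof. by move=> ha hb; apply: (homog_large (homogM ha hb)). Qed.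

Lemma top_odd_trivial m : top_odd (atrivial R M m).
Proof. by split; [exact: regular_trivial | exact: mc_trace_trivial | exact: mc_trace_trivial]. Qed.

Lemma top_odd_tensor V W : top_odd V -> top_odd W -> top_odd (atensor V W).
Proof.
move=> [Vr V1 V2] [Wr W1 W2]; split; first exact: regular_tensor.
  by rewrite mc_trace_tensor // V1 W1 !mul0rn addr0.
by rewrite mc_trace_tensor // V2 W2 !mul0rn addr0.
Qed.

Lemma top_odd_ext k V : top_odd V -> top_odd (aext k V).
Proof.
move=> [Vr V1 V2]; split; first exact: regular_ext.
  by rewrite mc_trace_ext // V1 scaler0.
by rewrite mc_trace_ext // V2 scaler0.
Qed.

(** Rank plus odd Chern character. Since forms of degree 7 multiply to zero, it
   behaves like a dual number, and the derivation rule for the odd Chern character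
   becomes multiplicativity. *)
Definition total_ch (W : abundle R M) : form := (arank W)%:R + ch1 W.

Lemma total_ch_tensor V W : top_odd V -> top_odd W ->
  total_ch (atensor V W) = total_ch V * total_ch W.
Proof.
move=> Vt Wt; have VWt := top_odd_tensor Vt Wt.
rewrite /total_ch mulrDl !mulrDr (mul_top_top (homog_ch_odd Vt) (homog_ch_odd Wt)) addr0.
rewrite -natrM -addrA; congr (_ + _).
have [Vr _ _] := Vt; have [Wr _ _] := Wt.
rewrite mulr_natl mulr_natr (ch_odd_bundle_top VWt) (ch_odd_bundle_top Vt).
rewrite (ch_odd_bundle_top Wt) (mc_trace_tensor _ Vr Wr).
exact: scale_mulrn2.
Qed.

Lemma ch_odd_trivial m : ch1 (atrivial R M m) = 0.
Proof.
by rewrite (ch_odd_bundle_top (top_odd_trivial m)) mc_trace_trivial scaler0.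
Qed.

Lemma ch_odd_ext k W : top_odd W -> ch1 (aext k W) = ch1 W *~ ext_coef (arank W) k 3.
Proof.
move=> Wt; have Et := top_odd_ext k Wt; have [Wr _ _] := Wt.
by rewrite (ch_odd_bundle_top Et) (ch_odd_bundle_top Wt) (mc_trace_ext _ _ Wr) scaler_int scalerMzr.
Qed.

(** [ext_coefE] is a convolution with the binomial coefficients, that is, with the
   series of the trivial bundle by which the reduced bundle divides. *)
Lemma total_ch_ext k W : top_odd W ->
  total_ch (aext k W) =
  convolve (fun j => if j is j'.+1 then ch1 W *~ ((-1) ^+ j' * (j'.+1 ^ 3)%:Z) else 1)
       (fun l => ('C(arank W, l))%:R) k.
Proof.
move=> Wt; rewrite /total_ch ch_odd_ext // [arank (aext k W)]card_increasing.
rewrite /convolve big_ord_recl mul1r subn0; congr (_ + _).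
rewrite ext_coefE mulrz_sumr; apply: eq_bigr => j _.
by rewrite mulr_natr PoszM mulrA mulrzA -pmulrn.
Qed.

Lemma total_ch_trivial m : total_ch (atrivial R M m) = m%:R.
Proof. by rewrite /total_ch ch_odd_trivial addr0. Qed.

Lemma total_ch_ext_trivial k m : total_ch (aext k (atrivial R M m)) = ('C(m, k))%:R.
Proof.
rewrite /total_ch ch_odd_ext; last exact: top_odd_trivial.
by rewrite ch_odd_trivial mul0rz addr0 [arank (aext k _)]card_increasing.
Qed.

Local Notation virt := (virtual (abundle_ops R M)).
Local Notation phi := (additive_ext (T := abundle_ops R M) total_ch).
Local Notation good := (all_bundles (T := abundle_ops R M) top_odd).

Lemma ch_oddE (V : virt) : good V -> ch_odd i x V = phi V - (aug (phi V))%:A.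
Proof.
elim: V => [_|v V IH] /=.
  by rewrite /ch_odd /additive_ext !big_nil rmorph0 scale0r subr0.
move=> [Wt /IH {}IH]; move: IH; rewrite /ch_odd /additive_ext !big_cons => ->.
have c0 : aug (ch1 v.2) = 0.
  by apply: (homog_ch_odd Wt); rewrite cards0.
rewrite rmorphD rmorphM rmorph_sign /total_ch rmorphD rmorph_nat /= c0 addr0.
rewrite scalerDl opprD addrACA; congr (_ + _).
rewrite mulrDr addrAC -[(_ * _)%:A]mulr_algl mulr1 -in_algE.
by rewrite rmorphM rmorph_sign rmorph_nat subrr add0r.
Qed.

Section Twisting.
Variables (E DE : abundle R M).
Hypotheses (Et : top_odd E) (Dt : top_odd DE).
Hypothesis DE_E : ch1 DE *+ 16 = - (ch1 E *+ arank DE).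
Local Notation F := (reduced (T := abundle_ops R M) E).
Local Notation c := (ch1 E).

Let triv := top_odd_trivial.
Let tens := top_odd_tensor.
Let exts := top_odd_ext.
Let mult := total_ch_tensor.
Let good_F : good F := all_bundles_reduced (T := abundle_ops R M) triv Et.

Let unit1 : total_ch (trivial (abundle_ops R M) 1) = 1.
Proof. exact: total_ch_trivial. Qed.

Lemma total_ch_reduced : phi F = c.
Proof. by rewrite additive_ext_reduced [total_ch (trivial _ _)]total_ch_trivial addrC addKr. Qed.

Lemma total_ch_vwedge k :
  phi (vwedge k F) = if k is k'.+1 then c *~ ((-1) ^+ k' * (k'.+1 ^ 3)%:Z) else 1.
Proof.
rewrite (additive_ext_vwedge_reduced (T := abundle_ops R M) triv tens exts mult unit1 k
  (m := fun k => if k is k'.+1 then c *~ ((-1) ^+ k' * (k'.+1 ^ 3)%:Z) else 1) Et) // => j.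
  exact: total_ch_ext_trivial.
exact: total_ch_ext.
Qed.

Let c_sq : c * c = 0.
Proof. exact: mul_top_top (homog_ch_odd Et) (homog_ch_odd Et). Qed.

(** The values -8 and 1 are (-1)^(m-1) m^3 for m = 2, 1, and 2 * (-8) + 1 = -15. *)
Lemma total_ch_B1 : phi (B1 F) = - (c *+ 15).
Proof.
rewrite (additive_ext_B1 (T := abundle_ops R M) mult good_F) total_ch_reduced !total_ch_vwedge.
rewrite c_sq subr0 -[X in _ + X]mulr1z !pmulrn -mulrzA -mulrzDr -mulrNz.
by congr (_ *~ _).
Qed.

(** Products of two factors vanish, and 2 * (-64) + 1 - 8 = -135 with the values
   of (-1)^(m-1) m^3 for m = 4, 1, 2. *)
Lemma total_ch_B2 : phi (B2 F) = - (c *+ 135).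
Proof.
rewrite (additive_ext_B2 (T := abundle_ops R M) triv tens exts mult good_F).
rewrite total_ch_reduced !total_ch_vwedge.
rewrite !mulrzAl !mulrzAr !c_sq !mul0r !mul0rz !mul0rn subr0 add0r !addr0 subr0.
rewrite -[X in _ + X + _]mulr1z !pmulrn -!mulrzA -!mulrzDr -mulrNz.
by congr (_ *~ _).
Qed.

Lemma ch_odd_twist (V : virt) m l : good V -> phi V = - (c *+ m) -> (16 * m = l)%N ->
  ch_odd i x (vtensor (vbundle (DE : bundle (abundle_ops R M))) V) = ch1 DE *+ l.
Proof.
move=> gV Vm <-.
have gD : good (vbundle (DE : bundle (abundle_ops R M))) by split.
rewrite ch_oddE; last exact: all_bundles_tensor.
rewrite (additive_ext_tensor (T := abundle_ops R M) mult gD gV) Vm additive_ext_bundle.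
rewrite /total_ch mulrN mulrnAr mulrDl (mul_top_top (homog_ch_odd Dt) (homog_ch_odd Et)) addr0.
have c0 : aug c = 0 by apply: (homog_ch_odd Et); rewrite cards0.
have -> : aug (- ((arank DE)%:R * c *+ m)) = 0.
  by rewrite rmorphN rmorphMn rmorphM /= c0 mulr0 mul0rn oppr0.
rewrite scale0r subr0 mulr_natl; exact: (twist_multiple _ DE_E).
Qed.

End Twisting.

End Degree7.

(** * The identities in top degree *)

Section TopCombination.
Variables (F : numFieldType) (n : nat).
Local Notation form := (ext_form F n).

Lemma aug0_mul_top (b D : form) : aug b = 0 -> homog n D -> b * D = 0.
Proof. by move=> b0 hD; rewrite mul_top // b0 scale0r. Qed.

Lemma homogMn p (D : form) m : homog p D -> homog p (D *+ m).
Proof. by move=> hD; rewrite -scaler_nat; exact: homogZ. Qed.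

Lemma degree_part_multiple (z : form) m : homog n z ->
  degree_part n (z *+ m) = m%:R * degree_part n z.
Proof.
move=> hz; rewrite (degree_part_homog (homogMn m hz)) (degree_part_homog hz).
by rewrite mulr_natl.
Qed.

Lemma top_combination (A a D : form) k m : homog n D ->
  degree_part n (A * (a * (D *+ m)) + k%:R * (A * (D *+ m))) =
  m%:R * degree_part n (A * a * D + k%:R * (A * D)).
Proof.
move=> hD; rewrite -degree_part_multiple; last first.
  by rewrite mulrA; apply: homogD; rewrite mul_top //; exact: homogZ.
by rewrite !mulrnAr mulrA mulrnDl.
Qed.

(** The forms b and c stand for the Chern characters of virtual bundles of rank 0; the
   common factor multiplying D on both sides is A a + k A. *)
Lemma top_combination1 (A a b c D : form) k m :
  homog n D -> aug b = 0 -> aug c = 0 ->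
  degree_part n (A * (b * D + a * (D *+ m)) + k%:R * (A * (c * D + D *+ m))) =
  m%:R * degree_part n (A * a * D + k%:R * (A * D)).
Proof.
by move=> hD b0 c0; rewrite (aug0_mul_top b0 hD) (aug0_mul_top c0 hD) !add0r top_combination.
Qed.

Lemma top_combination2 (A a b b' c c' D : form) k l m :
  homog n D -> aug b = 0 -> aug b' = 0 -> aug c = 0 -> aug c' = 0 ->
  degree_part n (A * (b * D + b' * (D *+ l) + a * (D *+ m))
    + k%:R * (A * (c * D + c' * (D *+ l) + D *+ m))) =
  m%:R * degree_part n (A * a * D + k%:R * (A * D)).
Proof.
move=> hD b0 b0' c0 c0'; have hDl := homogMn l hD.
rewrite (aug0_mul_top b0 hD) (aug0_mul_top c0 hD) (aug0_mul_top b0' hDl).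
by rewrite (aug0_mul_top c0' hDl) !add0r top_combination.
Qed.

Lemma form_mulrn_eq0 (t : form) m : (0 < m)%N -> t *+ m = 0 -> t = 0.
Proof.
move=> m0 /eqP; rewrite -scaler_nat scaler_eq0 pnatr_eq0 eqn0Ngt m0.
by move/eqP.
Qed.

Lemma scale_relation (k : F) (s t : form) p q :
  s *+ p = - (t *+ q) -> (k *: s) *+ p = - ((k *: t) *+ q).
Proof. by move=> st; rewrite !scalerMnr st scalerN. Qed.

End TopCombination.

Theorem theorem3p2 (R : realType) (M : topologicalType) (X : manifold R 7 M)
    (G : metric X) (S : spin_structure G)
    (N : nat) (N_even : ~~ odd N)
    (g : M -> 'M[R]_N)
    (g_smooth : smooth_map X g)
    (g_SO : forall p, special_orthogonal (g p))
    (gspin : M -> 'M[R[i]]_(spin_rank N))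
    (gspin_smooth : csmooth_map X gspin)
    (gspin_lift : forall p, spin_over (gspin p) (g p))
    (c3_eq0 : forall (i : ix X) (x : 'rV[R]_7), chart_image i x ->
      c3 i x (complexified g) = 0) :
  let T : virtual (cbundle_ops X) := reduced (complex_tangent S) in
  let DM : virtual (cbundle_ops X) := vbundle (spinor_bundle S) in
  let F : virtual (abundle_ops R M) := reduced (complexified g) in
  let DE : virtual (abundle_ops R M) :=
    vbundle {| arank := spin_rank N; automorphism := gspin |} in
  forall (i : ix X) (x : 'rV[R]_7), chart_image i x ->
  let A := Ahat S i x in
  let main_term :=
    degree_part 7 (A * ch i x DM * ch_odd i x DE + 32 * (A * ch_odd i x DE)) in
  degree_part 7
    (A * (ch i x (DM * (T *+ 2)) * ch_odd i x DE
          + ch i x DM * ch_odd i x (DE * B1 F))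
     + 32 * (A * (ch i x (T + \Lambda^2 T) * ch_odd i x DE
                  + ch_odd i x (DE * B1 F))))
  = 240 * main_term
  /\
  degree_part 7
    (A * (ch i x (DM * (T *+ 2 + \Lambda^2 T + T * T + \Sym^2 T)) * ch_odd i x DE
          + ch i x (DM * (T *+ 2)) * ch_odd i x (DE * B1 F)
          + ch i x DM * ch_odd i x (DE * B2 F))
     + 32 * (A * (ch i x (\Lambda^4 T + \Lambda^2 T * T + T * T + \Sym^2 T + T)
                    * ch_odd i x DE
                  + ch i x (T + \Lambda^2 T) * ch_odd i x (DE * B1 F)
                  + ch_odd i x (DE * B2 F))))
  = 2160 * main_term.
Proof.
move=> T DM F DE i x xi A.
pose E : abundle R M := complexified g.
pose DEb : abundle R M := {| arank := spin_rank N; automorphism := gspin |}.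
have Er : regular_at i x E := regular_orthogonal xi g_smooth g_SO.
have Dr : regular_at i x DEb := regular_spin xi N_even gspin_smooth gspin_lift.
have E1 : mc_trace i x 1 E = 0.
  have := c3_eq0 i x xi; rewrite /c3 => /eqP; rewrite scaler_eq0 invr_eq0 expf_eq0 /=.
  rewrite !mulf_eq0 pnatr_eq0 /= fmorph_eq0 (gt_eqF (pi_gt0 R)) /=.
  case/orP => [/eqP i0|/eqP //]; have := congr1 (@complex.Im R) i0 => /= /eqP.
  by rewrite oner_eq0.
have E2 := mc_trace_orthogonal2 xi g_smooth g_SO.
have Et : top_odd i x E := And3 Er E1 E2.
have D1 := mc_trace_spin1 xi N_even g_smooth g_SO gspin_smooth gspin_lift.
have D2 := mc_trace_spin2 xi N_even g_smooth g_SO gspin_smooth gspin_lift.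
have D3 := mc_trace_spin3 xi N_even g_smooth g_SO gspin_smooth gspin_lift.
have Dt : top_odd i x DEb.
  split; [exact: Dr | | exact: D2].
  by apply: (@form_mulrn_eq0 _ _ _ 8) => //; move: D1; rewrite -/E E1 mul0rn.
have DE_E : ch_odd_bundle i x DEb *+ 16 = - (ch_odd_bundle i x E *+ arank DEb).
  rewrite (ch_odd_bundle_top Dt) (ch_odd_bundle_top Et).
  exact: (scale_relation _ D3).
have gF : all_bundles (T := abundle_ops R M) (top_odd i x) F :=
  all_bundles_reduced (T := abundle_ops R M) (top_odd_trivial i x) Et.
have tens := top_odd_tensor (i := i) (x := x); have exts := top_odd_ext (i := i) (x := x).
have triv := top_odd_trivial i x.
have chDE : ch_odd i x DE = ch_odd_bundle i x DEb by rewrite /ch_odd additive_ext_bundle.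
have gB1 := all_bundles_B1 (T := abundle_ops R M) triv tens exts gF.
have gB2 := all_bundles_B2 (T := abundle_ops R M) triv tens exts gF.
have B1E : ch_odd i x (DE * B1 F) = ch_odd i x DE *+ 240.
  by rewrite chDE; exact: (ch_odd_twist Et Dt DE_E gB1 (total_ch_B1 Et) erefl).
have B2E : ch_odd i x (DE * B2 F) = ch_odd i x DE *+ 2160.
  by rewrite chDE; exact: (ch_odd_twist Et Dt DE_E gB2 (total_ch_B2 Et) erefl).
have hD : homog 7 (ch_odd i x DE) by rewrite chDE; exact: homog_ch_odd.
have TC0 : connection0 i x (complex_tangent S) := connection0_tangent i x S.
have gDM : all_bundles (T := cbundle_ops X) (connection0 i x) DM.
  by split=> //; exact: connection0_spinor.
have gT : all_bundles (T := cbundle_ops X) (connection0 i x) T :=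
  all_bundles_reduced (T := cbundle_ops X) (connection0_trivial i x) TC0.
have gw := good_vwedge TC0; have gs := good_vsym TC0.
have rT := rank_reduced TC0; have rw := rank_vwedge TC0; have rs := rank_vsym TC0.
have mult := rank_ch_tensor (i := i) (x := x).
have ctens := connection0_tensor (X := X) (i := i) (x := x).
have r1 : aug (ch i x (DM * (T *+ 2))) = 0.
  rewrite aug_ch (additive_ext_tensor (T := cbundle_ops X) mult gDM (all_bundles_muln 2 gT)).
  by rewrite additive_ext_muln rT mul0rn mulr0.
have r2 : aug (ch i x (T + \Lambda^2 T)) = 0.
  by rewrite aug_ch additive_ext_add rT rw addr0.
have gTT := all_bundles_tensor (T := cbundle_ops X) ctens gT gT.
have r3 : aug (ch i x (DM * (T *+ 2 + \Lambda^2 T + T * T + \Sym^2 T))) = 0.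
  have g3 := all_bundles_add (all_bundles_add
    (all_bundles_add (all_bundles_muln 2 gT) (gw 2%N)) gTT) (gs 2%N).
  rewrite aug_ch (additive_ext_tensor (T := cbundle_ops X) mult gDM g3).
  rewrite 3!additive_ext_add additive_ext_muln.
  rewrite (additive_ext_tensor (T := cbundle_ops X) mult gT gT).
  by rewrite rT rw rs mul0rn mul0r !addr0 mulr0.
have r4 : aug (ch i x (\Lambda^4 T + \Lambda^2 T * T + T * T + \Sym^2 T + T)) = 0.
  rewrite aug_ch 4!additive_ext_add (additive_ext_tensor (T := cbundle_ops X) mult gT gT).
  rewrite (additive_ext_tensor (T := cbundle_ops X) mult (gw 2%N) gT).
  by rewrite rT !rw rs mul0r !addr0.
by rewrite B1E B2E; split; [exact: top_combination1 | exact: top_combination2].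
Qed.
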